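(* Let $m,k\ge 1$ be integers and let $S_1,S_2,\dots$ be IID random elements of $\mathbb{S}_m$ with common law $P_S$. Assume that $\mathbb{E}_{P_S}\|\mathcal{V}(S)\|^2<\infty$, that for each $j\in\{1,\dots,k\}$ there exists a unique set $A^j\subset\mathbb{R}^{m(m+1)/2}$ with at most $j$ elements such that $\mathcal{Q}(A^j,P_S)=m_j(P_S)$, and that $P_S$ is supported on the compact set $\{S\in\mathbb{S}_m:\|\mathcal{V}(S)\|^2\le r\}$ for some $r>0$. For each $n$ let $X_n^k$ be a (measurably chosen) minimiser of $\mathcal{D}_n^k$. Then there are constants $C_1$ and $C_2$, depending only on $m$, $k$ and $r$, such that for all $n\ge 1$ $$\mathbb{E}\,\mathcal{Q}(X_n^k,P_S)-m_k(P_S)\le C_1 n^{-1/2},\qquad m_k(P_S)-\mathbb{E}\,\mathcal{D}_n^k(X_n^k)\le C_2 n^{-1/2},$$ where the expectations are over the sample $S_1,\dots,S_n$; and, as $n\to\infty$, $$\mathcal{Q}(X_n^k,P_S)-m_k(P_S)=O\big(n^{-1/2}\log^{1/2}n\big)\quad\text{almost surely.}$$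
   Context: $\mathbb{S}_m$ is the set of $m\times m$ real symmetric positive definite matrices. Each $S\in\mathbb{S}_m$ has a unique Cholesky factor $\mathscr{L}S$: the lower triangular matrix $L$ with positive diagonal such that $S=LL^T$. The map $\mathcal{V}:\mathbb{S}_m\to\mathbb{R}^{m(m+1)/2}$ is $\mathcal{V}(S)=(\ell_1,\dots,\ell_{m(m-1)/2},d_1,\dots,d_m)^T$, where $\ell_1,\dots,\ell_{m(m-1)/2}$ are the strictly lower triangular entries of $\mathscr{L}S$ listed in a fixed order and $d_i=\log\big((\mathscr{L}S)_{ii}\big)$. $\|\cdot\|$ is the Euclidean norm. For $X^k=\{X_1,\dots,X_k\}$ with $X_j\in\mathbb{R}^{m(m+1)/2}$ (not necessarily distinct), the $k$-means objective is $\mathcal{D}_n^k(X^k)=\frac1n\sum_{i=1}^n\min_{1\le j\le k}\|\mathcal{V}(S_i)-X_j\|^2$. For a probability measure $P$ on $\mathbb{S}_m$ and a finite nonempty set $A\subset\mathbb{R}^{m(m+1)/2}$, $\mathcal{Q}(A,P)=\mathbb{E}_{S\sim P}\big[\min_{\alpha\in A}\|\mathcal{V}(S)-\alpha\|^2\big]$ and $m_j(P)=\inf\{\mathcal{Q}(A,P): 1\le \#A\le j\}$. Thus $\mathcal{Q}(X_n^k,P_S)$ is a random variable, a function of the sample: the function $A\mapsto\mathcal{Q}(A,P_S)$ evaluated at the random set $A=X_n^k$. *)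

(* Defs.v *)
From HB Require Import structures.
From mathcomp Require Import all_boot all_order all_algebra.
From mathcomp Require Import finmap zify.
From mathcomp Require Import all_classical all_reals all_analysis.

Set Implicit Arguments.
Unset Strict Implicit.
Unset Printing Implicit Defensive.

Import Order.TTheory GRing.Theory Num.Theory.
Import numFieldNormedType.Exports.

Local Open Scope classical_set_scope.
Local Open Scope ring_scope.

Definition sym_posdef (R : realType) (m : nat) (A : 'M[R]_m) : Prop :=
  A^T = A /\ forall x : 'cV[R]_m, x != 0 -> 0 < (x^T *m A *m x) 0 0.

Record spd (R : realType) (m : nat) := Spd {
  spd_mx :> 'M[R]_m;
  _ : `[< sym_posdef spd_mx >] }.

HB.instance Definition _ (R : realType) (m : nat) :=
  [isSub for @spd_mx R m].
HB.instance Definition _ (R : realType) (m : nat) :=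
  [Choice of spd R m by <:].

Lemma sym_posdef1 (R : realType) (m : nat) : `[< sym_posdef (1%:M : 'M[R]_m) >].
Proof.
apply/asboolP; split=> [|x x0]; first exact: trmx1.
rewrite mulmx1 mxE lt_neqAle eq_sym; apply/andP; split; last first.
  by apply: sumr_ge0 => i _; rewrite mxE -expr2 sqr_ge0.
rewrite psumr_neq0; last by move=> i _; rewrite mxE -expr2 sqr_ge0.
apply: contraNT x0 => /hasPn H; apply/eqP/colP => i; rewrite mxE.
have := H i (mem_index_enum _); rewrite /= mxE -expr2 lt_neqAle sqr_ge0 andbT.
by rewrite negbK eq_sym sqrf_eq0 => /eqP.
Qed.

HB.instance Definition _ (R : realType) (m : nat) :=
  isPointed.Build (spd R m) (Spd (sym_posdef1 R m)).

(* The topology induced by that of the matrices, and its Borel sigma-algebra. *)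
HB.instance Definition _ (R : realType) (m : nat) :=
  Topological.copy (spd R m) (initial_topology (@spd_mx R m)).
HB.instance Definition _ (R : realType) (m : nat) :=
  Measurable.copy (spd R m) (g_sigma_algebraType (@open (spd R m))).

Definition is_cholesky (R : realType) (m : nat) (S L : 'M[R]_m) : Prop :=
  [/\ is_trig_mx L, forall i, 0 < L i i & S = L *m L^T].

(* For S in spd R m the factor exists and is unique, so that the default
   value 0 of xget is never used. *)
Definition cholesky (R : realType) (m : nat) (S : spd R m) : 'M[R]_m :=
  xget 0 [set L | is_cholesky S L].

Definition strict_lower (m : nat) : {set 'I_m * 'I_m} :=
  [set p : 'I_m * 'I_m | (p.2 < p.1)%N].

Definition vdim (m : nat) : nat := (#|strict_lower m| + m)%N.

Lemma vdimE (m : nat) : vdim m = ((m * m.+1)./2)%N.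
Proof.
rewrite /vdim -sum1_card (eq_bigl (fun p : 'I_m * 'I_m => (p.2 < p.1)%N));
  last by move=> p; rewrite inE.
rewrite -(pair_big_dep xpredT (fun i j : 'I_m => (j < i)%N) (fun _ _ => 1%N)) /=.
have -> : (\sum_(i < m) \sum_(j < m | (j < i)%N) 1 = \sum_(i < m) i)%N.
  apply: eq_bigr => i _.
  rewrite -[RHS](card_ord i) -sum1_card.
  by rewrite -(big_ord_widen m (fun _ => 1%N)) // ltnW.
rewrite -(big_mkord xpredT id) /= bin2_sum bin2.
have -> : (m * m.+1 = m * m.-1 + m.*2)%N by case: m => [//|m]; nia.
by rewrite halfD odd_double andbF doubleK.
Qed.

(* First the strictly lower triangular entries of the Cholesky factor, in the
   order in which strict_lower m is enumerated, then the logarithms of its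
   diagonal entries. *)
Definition vmap (R : realType) (m : nat) (S : spd R m) : 'rV[R]_(vdim m) :=
  row_mx
    (\row_(i < #|strict_lower m|)
       cholesky S (enum_val i).1 (enum_val i).2)
    (\row_(i < m) ln (cholesky S i i)).

(* The norm `|x| of the library on row vectors is the sup norm. *)
Definition enorm (R : realType) (d : nat) (x : 'rV[R]_d) : R :=
  Num.sqrt (\sum_(i < d) x 0 i ^+ 2).

(* Used for finite nonempty A only, where the infimum is a minimum. *)
Definition min_sqdist (R : realType) (d : nat) (x : 'rV[R]_d)
    (A : set 'rV[R]_d) : R :=
  inf [set enorm (x - a) ^+ 2 | a in A].

(* The codebook is a family x : 'I_k -> _, so repetitions are allowed. *)
Definition kmeans_obj (R : realType) (m k n : nat) (s : n.-tuple (spd R m))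
    (x : 'I_k -> 'rV[R]_(vdim m)) : R :=
  n%:R^-1 * \sum_(i < n) min_sqdist (vmap (tnth s i)) (range x).

Definition is_minimiser (R : realType) (m k n : nat) (s : n.-tuple (spd R m))
    (x : 'I_k -> 'rV[R]_(vdim m)) : Prop :=
  forall y : 'I_k -> 'rV[R]_(vdim m), kmeans_obj s x <= kmeans_obj s y.

Definition Qrisk (R : realType) (m : nat) (A : set 'rV[R]_(vdim m))
    (PS : probability (spd R m) R) : \bar R :=
  'E_PS[fun S => min_sqdist (vmap S) A]%E.

Definition card_between_1_and (T : Type) (j : nat) (A : set T) : Prop :=
  A !=set0 /\ (A #<= `I_j)%card.

Definition opt_risk (R : realType) (m j : nat)
    (PS : probability (spd R m) R) : \bar R :=
  ereal_inf [set Qrisk A PS | A in card_between_1_and j].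

Definition mutually_independent d d' (T : measurableType d)
    (T' : measurableType d') (R : realType) (P : probability T R)
    (S : nat -> T -> T') : Prop :=
  forall (J : {fset nat}) (B : nat -> set T'), (forall i, measurable (B i)) ->
    P (\bigcap_(i in [set` J]) (S i @^-1` B i)) =
    (\prod_(i <- J) P (S i @^-1` B i))%E.

Definition iid_with_law d d' (T : measurableType d)
    (T' : measurableType d') (R : realType) (P : probability T R)
    (S : nat -> {RV P >-> T'}) (Q : probability T' R) : Prop :=
  (forall i (B : set T'), measurable B -> distribution P (S i) B = Q B) /\
  mutually_independent P S.

(* S is indexed from 0: the first n observations are S 0, ..., S n.-1. *)
Definition sample (T T' : Type) (S : nat -> T -> T') (n : nat) (w : T) :
    n.-tuple T' :=
  [tuple S i w | i < n].

(* Main.v *)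
Require Import Defs.
From HB Require Import structures.
From mathcomp Require Import all_boot all_order all_algebra.
From mathcomp Require Import finmap zify ring lra.
From mathcomp Require Import all_classical all_reals all_analysis.
From mathcomp Require Import measurable_realfun.

(* Let rho = sqrt r. Only codebooks with all centres in the cube [-rho, rho]^d
   matter: clipping a centre decreases its
   distance to every point of the support, and the centres of an empirical
   minimiser that serve some sample point already lie in the cube. Hence all
   three claims reduce to bounds on the supremum, over such codebooks x, of the
   deviation |Q(x) - D_n(x)|. The squared distances are bounded and Lipschitz
   in x, uniformly on the support, so Hoeffding-type exponential moments
   control the increments of the deviation between neighbouring points of
   dyadic grids of the finite-dimensional parameter cube; summing over the
   levels (chaining) gives n^(-1/2) without a logarithm. For the almost sure
   rate a single grid of mesh 1/n and the Borel-Cantelli lemma suffice. *)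

Set Implicit Arguments.
Unset Strict Implicit.
Unset Printing Implicit Defensive.

Import Order.TTheory GRing.Theory Num.Theory.
Import numFieldNormedType.Exports.

Local Open Scope classical_set_scope.
Local Open Scope ring_scope.

(** * Exponential moments of empirical means *)

(** No supremum over an uncountable family of codebooks is ever formed: it is replaced by an
    explicit measurable majorant, a finite sum of soft maxima over grids, and the minimiser is
    compared with that majorant for almost every sample. In the chain the increments at level [l]
    have size of order [2^-l], so they tolerate an exponential parameter [sqrt n * 2^l] with moments
    bounded independently of [l] and [n]. The logarithm of the number of grid points grows only
    linearly in [l]; level [l] thus costs about [l / (2^l * sqrt n)], which is summable. The
    obstacle in the reduction to the cube is that a minimiser may have idle centres, nearest to no
    sample point and arbitrarily far away. They are replaced by a centre in use, which leaves the
    objective unchanged and can only increase the risk. *)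

(** Stands in for Hoeffding's lemma: for a centred variable the linear term integrates to 0 and a
    Gaussian bound remains. For [t > 1/3] already [t <= 3 * t ^+ 2]. *)
Lemma expR_le_add (R : realType) (t : R) : expR t <= t + expR (3 * t ^+ 2).
Proof.
have [t3|t3] := leP t (1/3); last first.
  apply: (@le_trans _ _ (expR (3 * t ^+ 2))); last by lra.
  by rewrite ler_expR; nra.
apply: (@le_trans _ _ (t + (1 + 3 * t ^+ 2))); last first.
  by rewrite lerD2l expR_ge1Dx.
(* Squaring this bound gives [expR t <= (1 - t / 2) ^- 2], which is at most [1 + t + t ^+ 2] as long
   as [t <= 1/3]. *)
have h : 1 - t / 2 <= expR (- (t / 2)) by rewrite expR_ge1Dx.
have p0 : 0 < 1 - t / 2 by lra.
have e0 := expR_gt0 (t / 2).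
have eE : expR t = expR (t / 2) ^+ 2.
  by rewrite expr2 -expRD; congr expR; field.
have e1 : expR (t / 2) * (1 - t / 2) <= 1.
  by rewrite -[leRHS](expRxMexpNx_1 (t / 2)) ler_wpM2l// ltW.
have : expR t * (1 - t / 2) ^+ 2 <= 1.
  rewrite eE -exprMn expr_le1//; rewrite mulr_ge0// ltW//.
have : 1 <= (1 + t + t ^+ 2) * (1 - t / 2) ^+ 2.
  rewrite -subr_ge0.
  have -> : (1 + t + t ^+ 2) * (1 - t / 2) ^+ 2 - 1 =
    t ^+ 2 / 4 * (1 - 3 * t + t ^+ 2) by field.
  by apply: mulr_ge0; nra.
move=> a b.
have : expR t <= 1 + t + t ^+ 2.
  rewrite -(@ler_pM2r _ ((1 - t / 2) ^+ 2)) ?exprn_gt0//; exact: le_trans b a.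
nra.
Qed.

Section independence.
Local Open Scope ereal_scope.
Import HBNNSimple.

(** Independence of the weight [W] and of [X] enters through indicators; linearity carries it to
    simple functions and monotone convergence to nonnegative [h]. The weight makes the result usable
    in an induction on the number of observations. *)
Lemma ge0_integral_indep d d' (T : measurableType d) (T' : measurableType d')
    (R : realType) (P : {measure set T -> \bar R}) (Q : {measure set T' -> \bar R})
    (W : T -> R) (X : T -> T') (h : T' -> \bar R) :
  measurable_fun setT W -> (forall w, (0 <= W w)%R) ->
  \int[P]_w (W w)%:E \is a fin_num -> measurable_fun setT X ->
  (forall B, measurable B ->
     \int[P]_w ((W w)%:E * (\1_B (X w))%:E) = \int[P]_w (W w)%:E * Q B) ->
  measurable_fun setT h -> (forall y, 0 <= h y) ->
  \int[P]_w ((W w)%:E * h (X w)) = \int[P]_w (W w)%:E * \int[Q]_y h y.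
Proof.
move=> mW' W0' Wfin mX WX mh h0.
have mW : measurable_fun setT (fun w => (W w)%:E) by exact/measurable_EFinP.
have W0 w : 0 <= (W w)%:E by rewrite lee_fin.
have simple (f : {nnsfun T' >-> R}) :
    \int[P]_w ((W w)%:E * (f (X w))%:E) =
    \int[P]_w (W w)%:E * \int[Q]_y (f y)%:E.
  have fE y : (f y)%:E =
      \sum_(r \in range f) (r * \1_(f @^-1` [set r]) y)%:E :> \bar R.
    by rewrite fimfunE -fsumEFin.
  have rge0 r y : 0 <= (r * \1_(f @^-1` [set r]) y)%:E.
    by rewrite lee_fin; exact: nnfun_muleindic_ge0.
  have mind r : measurable_fun setT (fun y => (r * \1_(f @^-1` [set r]) y)%:E).
    by apply/measurable_EFinP/measurable_funM.
  transitivity (\int[P]_w \sum_(r \in range f)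
      ((W w)%:E * (r * \1_(f @^-1` [set r]) (X w))%:E)).
    by apply: eq_integral => w _; rewrite fE ge0_mule_fsumr.
  rewrite ge0_integral_fsum//; last 2 first.
  - move=> r; apply: emeasurable_funM => //.
    exact: (measurableT_comp (mind r)).
  - by move=> r w _; rewrite mule_ge0.
  rewrite [X in _ = _ * X](eq_integral _ _ (fun y _ => fE y)).
  rewrite ge0_integral_fsum// ge0_mule_fsumr; last first.
    by move=> r; rewrite integral_ge0.
  apply: eq_fsbigr => r /set_mem [y _ ry].
  have r0 : (0 <= r)%R by rewrite -ry.
  have mB : measurable (f @^-1` [set r]) by [].
  under eq_integral do rewrite EFinM muleCA.
  rewrite ge0_integralZl_EFin//; last 2 first.
  - by move=> w _; rewrite mule_ge0// lee_fin.
  - apply: emeasurable_funM => //; apply/measurable_EFinP.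
    by apply: measurableT_comp.
  rewrite WX// muleCA; congr (_ * _).
  under [RHS]eq_integral do rewrite EFinM.
  rewrite ge0_integralZl_EFin//; last by apply/measurable_EFinP.
  by rewrite integral_indic// setIT.
pose g := nnsfun_approx measurableT mh.
have gnd y : {homo (fun n => (g n y)%:E) : a b / (a <= b)%N >-> a <= b}.
  by move=> a b ab; rewrite lee_fin; exact/lefP/nd_nnsfun_approx.
have gcvg y : (g n y)%:E @[n --> \oo] --> h y by exact: cvg_nnsfun_approx.
have mg n : measurable_fun setT (fun y => (g n y)%:E).
  exact/measurable_EFinP.
have g0 n y : 0 <= (g n y)%:E by rewrite lee_fin.
have -> : \int[P]_w ((W w)%:E * h (X w)) =
    limn (fun n => \int[P]_w ((W w)%:E * (g n (X w))%:E)).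
  rewrite -monotone_convergence//.
  - apply: eq_integral => w _; apply/esym/cvg_lim => //.
    by apply: cvgeZl.
  - by move=> n; apply: emeasurable_funM => //; exact: (measurableT_comp (mg n)).
  - by move=> n w _; rewrite mule_ge0.
  - by move=> w _ a b ab; rewrite lee_wpmul2l//; exact: gnd.
have -> : \int[Q]_y h y = limn (fun n => \int[Q]_y (g n y)%:E).
  rewrite -monotone_convergence//.
  by apply: eq_integral => y _; apply/esym/cvg_lim.
rewrite -limeMl//.
  by congr (limn _); apply/funext => n; exact: simple.
apply/ereal_nondecreasing_is_cvgn => a b ab; apply: ge0_le_integral => //.
by move=> y _; exact: gnd.
Qed.

End independence.

Section iid.
Context d d' (T : measurableType d) (T' : measurableType d') (R : realType)
  (P : probability T R) (S : nat -> {RV P >-> T'}) (PS : probability T' R).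
Hypothesis iidS : iid_with_law S PS.

Lemma iid_law i (B : set T') : measurable B -> P (S i @^-1` B) = PS B.
Proof. by move=> mB; rewrite -(iidS.1 i). Qed.

Lemma iid_bigcap (J : {fset nat}) (B : nat -> set T') :
  (forall i, measurable (B i)) ->
  P (\bigcap_(i in [set` J]) (S i @^-1` B i)) = (\prod_(i <- J) PS (B i))%E.
Proof.
move=> mB; rewrite iidS.2//; apply: eq_bigr => i _; exact: iid_law.
Qed.

(** The indicator over later indices [J] is there for the induction on [n]: the case [n = 0] is
    independence of events, and each step trades one event for a factor [h]. *)
Lemma iid_integral_prod_indic (h : T' -> R) (n : nat) (J : {fset nat})
    (B : nat -> set T') :
  measurable_fun setT h -> (forall y, 0 <= h y) ->
  (\int[PS]_y (h y)%:E)%E \is a fin_num -> (forall i, measurable (B i)) ->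
  (forall i, i \in J -> (n <= i)%N) ->
  (\int[P]_w ((\prod_(i < n) h (S i w)) *
      \1_(\bigcap_(i in [set` J]) (S i @^-1` B i)) w)%:E =
   ((\int[PS]_y h y) ^+ n)%:E * \prod_(i <- J) PS (B i))%E.
Proof.
move=> mh h0 hfin; elim: n J B => [|n IH] J B mB Jn.
  rewrite expr0 mul1e -iid_bigcap//.
  under eq_integral do rewrite big_ord0 mul1r.
  rewrite integral_indic ?setIT//; apply: bigcap_measurableType => i _.
  by rewrite -[X in measurable X]setTI; exact: measurable_funP.
have mcap (K : {fset nat}) (C : nat -> set T') : (forall i, measurable (C i)) ->
    measurable (\bigcap_(i in [set` K]) (S i @^-1` C i)).
  move=> mC; apply: bigcap_measurableType => i _.
  by rewrite -[X in measurable X]setTI; exact: measurable_funP.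
pose W w := (\prod_(i < n) h (S i w)) *
      \1_(\bigcap_(i in [set` J]) (S i @^-1` B i)) w.
have Jn' i : i \in J -> (n <= i)%N by move=> /Jn/ltnW.
have IW : (\int[P]_w (W w)%:E = ((\int[PS]_y h y) ^+ n)%:E *
    \prod_(i <- J) PS (B i))%E by rewrite /W IH.
have Wfin : (\int[P]_w (W w)%:E)%E \is a fin_num.
  rewrite IW fin_numM// prode_fin_num// => i _; exact: fin_num_measure.
have W0 w : 0 <= W w by rewrite mulr_ge0// prodr_ge0.
have mW : measurable_fun setT W.
  apply: measurable_funM; last exact/measurable_indic/mcap.
  by apply: measurable_prod => i _; exact: measurableT_comp.
transitivity (\int[P]_w ((W w)%:E * (h (S n w))%:E))%E.
  by apply: eq_integral => w _; rewrite -EFinM big_ord_recr/= /W mulrAC.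
(* Independence of [W] and [S n] is the induction hypothesis with [n] adjoined to [J] and with [C]
   as the event at [n]. *)
have WX C : measurable C -> (\int[P]_w ((W w)%:E * (\1_C (S n w))%:E) =
    \int[P]_w (W w)%:E * PS C)%E.
  move=> mC; pose C' i := if i == n then C else B i.
  have mC' i : measurable (C' i) by rewrite /C'; case: ifP.
  have nJ : n \notin J by apply/negP => /Jn; rewrite ltnn.
  have C'J i : i \in J -> C' i = B i.
    by rewrite /C'; case: eqP => // -> /Jn; rewrite ltnn.
  transitivity (\int[P]_w ((\prod_(i < n) h (S i w)) *
      \1_(\bigcap_(i in [set` (n |` J)%fset]) (S i @^-1` C' i)) w)%:E)%E.
    apply: eq_integral => w _; rewrite -EFinM /W -mulrA; congr (_ * _)%:E.
    rewrite bigcap_fsetU1 {1}/C' eqxx indicI/= mulrC; congr (_ * _).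
    by congr (\1_(_) _); apply: eq_bigcapr => i /= /C'J <-.
  rewrite IH//; last by move=> i; rewrite !inE => /orP[/eqP->//|/Jn'].
  rewrite big_fsetU1//= {1}/C' eqxx IW -muleA; congr (_ * _)%E.
  rewrite muleC; congr (_ * _)%E.
  by rewrite big_seq [RHS]big_seq; apply: eq_bigr => i /C'J ->.
rewrite (@ge0_integral_indep _ _ _ _ _ _ PS _ _ (EFin \o h))//; last first.
  exact/measurable_EFinP.
rewrite IW /= exprSr EFinM muleAC; congr (_ * _ * _)%E.
by rewrite /Rintegral fineK.
Qed.

Lemma iid_integral_prod (h : T' -> R) (n : nat) :
  measurable_fun setT h -> (forall y, 0 <= h y) ->
  (\int[PS]_y (h y)%:E)%E \is a fin_num ->
  (\int[P]_w (\prod_(i < n) h (S i w))%:E = ((\int[PS]_y h y) ^+ n)%:E)%E.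
Proof.
move=> mh h0 hfin.
have := @iid_integral_prod_indic h n fset0 (fun=> setT) mh h0 hfin.
rewrite big_seq_fset0 mule1 => <-//; apply: eq_integral => w _.
by rewrite set_fset0 bigcap_set0 indicT mulr1.
Qed.

End iid.

Lemma bounded_integrable d (T : measurableType d) (R : realType)
    (P : probability T R) (f : T -> R) (b : R) :
  measurable_fun setT f -> (forall y, `|f y| <= b) ->
  P.-integrable setT (EFin \o f).
Proof.
move=> mf fb; apply: measurable_bounded_integrable => //.
  by rewrite -ge0_fin_numE//; exact: fin_num_measure.
exists b; split; first exact: num_real.
by move=> x bx y _; apply: le_trans (fb y) _; exact: ltW.
Qed.

Lemma prob_Rintegral_cst d (T : measurableType d) (R : realType)
    (P : probability T R) (c : R) : \int[P]_y c = c.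
Proof.
rewrite Rintegral_cst//.
have -> : fine (P setT) = 1 by rewrite probability_setT.
by rewrite mulr1.
Qed.

Section deviation.
Context d d' (T : measurableType d) (T' : measurableType d') (R : realType)
  (P : probability T R) (S : nat -> {RV P >-> T'}) (PS : probability T' R).
Hypothesis iidS : iid_with_law S PS.

Definition deviation (f : T' -> R) (n : nat) (w : T) : R :=
  \int[PS]_y f y - n%:R^-1 * \sum_(i < n) f (S i w).

Lemma measurable_deviation (f : T' -> R) n :
  measurable_fun setT f -> measurable_fun setT (deviation f n).
Proof.
move=> mf; apply: measurable_funB => //; apply: measurable_funM => //.
by apply: measurable_sum => i; exact: measurableT_comp.
Qed.

Lemma deviationB (f g : T' -> R) n w b :
  measurable_fun setT f -> (forall y, `|f y| <= b) ->
  measurable_fun setT g -> (forall y, `|g y| <= b) ->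
  deviation (fun y => f y - g y) n w = deviation f n w - deviation g n w.
Proof.
move=> mf fb mg gb; rewrite /deviation RintegralB//; last 2 first.
- exact: bounded_integrable fb.
- exact: bounded_integrable gb.
by rewrite sumrB; ring.
Qed.

Lemma Rintegral_bound (f : T' -> R) b : measurable_fun setT f ->
  (forall y, `|f y| <= b) -> `|\int[PS]_y f y| <= b.
Proof.
move=> mf fb; rewrite (le_trans (le_normr_Rintegral _ _))//.
  exact: bounded_integrable fb.
rewrite -[leRHS](prob_Rintegral_cst PS); apply: le_Rintegral => //.
- apply: (@bounded_integrable _ _ _ _ _ b); first exact: measurableT_comp.
  by move=> y; rewrite normr_id.
- exact: (@bounded_integrable _ _ _ _ _ `|b|).
Qed.

Lemma deviation_bound (f : T' -> R) b n w : (0 < n)%N -> measurable_fun setT f ->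
  (forall y, `|f y| <= b) -> `|deviation f n w| <= 2 * b.
Proof.
move=> n0 mf fb; rewrite (le_trans (ler_normB _ _))// mulr_natl mulr2n lerD//.
  exact: Rintegral_bound.
rewrite normrM ger0_norm ?invr_ge0// mulrC ler_pdivrMr ?ltr0n//.
rewrite (le_trans (ler_norm_sum _ _ _))//.
apply: (@le_trans _ _ (\sum_(i < n) b)); first exact: ler_sum.
by rewrite sumr_const card_ord mulr_natr.
Qed.

(** The exponential splits into [n] independent factors with parameter [s = t / n]. Since
    [|mu - f y| <= 2 * b], each contributes at most [expR (3 * s ^+ 2 * (2 * b) ^+ 2)], whence the
    constant 12. *)
Lemma expR_deviation (f : T' -> R) b n t : (0 < n)%N -> measurable_fun setT f ->
  (forall y, `|f y| <= b) ->
  (\int[P]_w (expR (t * deviation f n w))%:E <=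
   (expR (12 * t ^+ 2 * b ^+ 2 / n%:R))%:E)%E.
Proof.
move=> n0 mf fb; set mu := \int[PS]_y f y.
have n0' : n%:R != 0 :> R by rewrite pnatr_eq0 -lt0n.
pose s := t / n%:R; pose h y := expR (s * (mu - f y)).
have mub : `|mu| <= b by exact: Rintegral_bound.
have b0 : 0 <= b by rewrite (le_trans _ mub).
have cb y : `|mu - f y| <= 2 * b.
  by rewrite (le_trans (ler_normB _ _))// mulr_natl mulr2n lerD.
have mh' : measurable_fun setT (fun y => s * (mu - f y)).
  by apply: measurable_funM => //; exact: measurable_funB.
have mh : measurable_fun setT h by exact: measurableT_comp.
have hb' y : `|s * (mu - f y)| <= `|s| * (2 * b) by rewrite normrM ler_wpM2l.
have hb y : `|h y| <= expR (`|s| * (2 * b)).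
  by rewrite ger0_norm ?expR_ge0// ler_expR (le_trans (ler_norm _)).
have ih := bounded_integrable PS mh hb.
have hle : \int[PS]_y h y <= expR (12 * s ^+ 2 * b ^+ 2).
  (* The added linear term has integral 0, [mu] being the mean of [f]; the two integrands can then
     be compared pointwise by [expR_le_add]. *)
  have -> : expR (12 * s ^+ 2 * b ^+ 2) =
      \int[PS]_y (s * (mu - f y) + expR (12 * s ^+ 2 * b ^+ 2)).
    rewrite RintegralD//; last 2 first.
    - exact: bounded_integrable hb'.
    - exact: (@bounded_integrable _ _ _ _ _ `|expR (12 * s ^+ 2 * b ^+ 2)|).
    rewrite prob_Rintegral_cst RintegralZl//; last first.
      by apply: bounded_integrable cb; exact: measurable_funB.
    rewrite RintegralB//; last 2 first.
    - exact: (@bounded_integrable _ _ _ _ _ `|mu|).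
    - exact: bounded_integrable fb.
    by rewrite prob_Rintegral_cst subrr mulr0 add0r.
  apply: le_Rintegral => //.
    apply: (@bounded_integrable _ _ _ _ _
      (`|s| * (2 * b) + `|expR (12 * s ^+ 2 * b ^+ 2)|)).
      exact: measurable_funD.
    by move=> y; rewrite (le_trans (ler_normD _ _))// lerD.
  move=> y _; rewrite (le_trans (expR_le_add _))// lerD2l ler_expR exprMn.
  have : (mu - f y) ^+ 2 <= (2 * b) ^+ 2.
    by rewrite -real_normK ?num_real// lerXn2r// nnegrE// mulr_ge0.
  by have := sqr_ge0 s; nra.
rewrite (_ : (\int[P]_w _ = \int[P]_w (\prod_(i < n) h (S i w))%:E)%E); last first.
  apply: eq_integral => w _; congr EFin; rewrite -expR_sum; congr expR.
  rewrite -mulr_sumr sumrB sumr_const card_ord /deviation -/mu -mulr_natr /s.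
  by field.
rewrite (iid_integral_prod iidS)//; last 2 first.
- by move=> y; exact: expR_ge0.
- exact: integrable_fin_num.
rewrite lee_fin (_ : expR _ = expR (12 * s ^+ 2 * b ^+ 2) ^+ n); last first.
  rewrite -expRM_natl; congr expR; rewrite /s; field.
  exact: n0'.
rewrite lerXn2r// nnegrE ?expR_ge0//.
by apply: Rintegral_ge0 => y _; exact: expR_ge0.
Qed.

End deviation.

Section softmax.
Context d (T : measurableType d) (R : realType) (U : finType).
Implicit Types (G : U -> T -> R) (lam a : R).

(** Both signs occur, so the sum controls [|G u w|] for all [u] at once. It serves twice: inside
    [softmax] for expectations, and alone for tails, since a value below 1 forces
    [lam * |G u w| <= a] for every [u]. *)
Definition expsum G lam a (w : T) : R :=
  \sum_u (expR (lam * G u w - a) + expR (- lam * G u w - a)).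

Lemma measurable_expsum G lam a : (forall u, measurable_fun setT (G u)) ->
  measurable_fun setT (expsum G lam a).
Proof.
move=> mG; apply: measurable_sum => u.
by apply: measurable_funD; apply: measurableT_comp => //;
  apply: measurable_funB => //; apply: measurable_funM.
Qed.

Lemma expsum_ge0 G lam a w : 0 <= expsum G lam a w.
Proof. by apply: sumr_ge0 => u _; rewrite addr_ge0// expR_ge0. Qed.

Lemma le_expsum G lam a u w : 0 <= lam ->
  lam * `|G u w| <= a - 1 + expsum G lam a w.
Proof.
move=> l0; rewrite /expsum (bigD1 u)//=.
set s := (\sum_(i | _) _).
have s0 : 0 <= s by apply: sumr_ge0 => v _; rewrite addr_ge0// expR_ge0.
have := expR_ge1Dx (lam * G u w - a); have := expR_ge0 (lam * G u w - a).
have := expR_ge1Dx (- lam * G u w - a); have := expR_ge0 (- lam * G u w - a).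
by case: (ger0P (G u w)) => _; lra.
Qed.

Lemma integral_expsum (P : probability T R) G lam a E :
  (forall u, measurable_fun setT (G u)) ->
  (forall u, (\int[P]_w (expR (lam * G u w))%:E <= E%:E)%E) ->
  (forall u, (\int[P]_w (expR (- lam * G u w))%:E <= E%:E)%E) ->
  (\int[P]_w (expsum G lam a w)%:E <= (#|U|%:R * 2 * E / expR a)%:E)%E.
Proof.
move=> mG GE GE'.
have mexp t u : measurable_fun setT (fun w => (expR (t * G u w))%:E).
  apply/measurable_EFinP; apply: measurableT_comp => //.
  exact: measurable_funM.
have mexp' t u : measurable_fun setT
    (fun w => (expR (- a))%:E * (expR (t * G u w))%:E)%E.
  exact: emeasurable_funM.
have bound t u : (\int[P]_w (expR (t * G u w))%:E <= E%:E)%E ->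
    (\int[P]_w ((expR (- a))%:E * (expR (t * G u w))%:E) <=
     (expR (- a) * E)%:E)%E.
  have p0 w : (0 <= (expR (t * G u w))%:E)%E by rewrite lee_fin expR_ge0.
  move=> tE; rewrite ge0_integralZl_EFin ?expR_ge0//.
  by rewrite EFinM lee_wpmul2l// lee_fin expR_ge0.
have sumE w : (expsum G lam a w)%:E =
    (\sum_u ((expR (- a))%:E * (expR (lam * G u w))%:E +
            (expR (- a))%:E * (expR (- lam * G u w))%:E))%E.
  rewrite /expsum -sumEFin; apply: eq_bigr => u _.
  by rewrite -!EFinM -EFinD -!expRD ![- a + _]addrC.
have e0 t u w : (0 <= (expR (- a))%:E * (expR (t * G u w))%:E)%E.
  by rewrite -EFinM lee_fin mulr_ge0// expR_ge0.
under eq_integral do rewrite sumE.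
rewrite ge0_integral_sum//; last 2 first.
- by move=> u; exact: emeasurable_funD.
- by move=> u w _; rewrite adde_ge0.
apply: (@le_trans _ _
    (\sum_(u : U) (expR (- a) * E + expR (- a) * E)%:E)%E).
  by apply: lee_sum => u _; rewrite ge0_integralD// EFinD leeD// bound.
rewrite sumEFin lee_fin sumr_const.
have -> : (expR (- a) * E + expR (- a) * E) *+ #|U| = #|U|%:R * 2 * E / expR a.
  by rewrite expRN -mulr_natr; ring.
exact: lexx.
Qed.

(* A smooth upper bound of max_u |G u w|, from y <= a - 1 + exp (y - a); it is
   measurable and needs no Jensen inequality to integrate. *)
Definition softmax G lam a (w : T) : R := lam^-1 * (a - 1 + expsum G lam a w).

Lemma measurable_softmax G lam a : (forall u, measurable_fun setT (G u)) ->
  measurable_fun setT (softmax G lam a).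
Proof.
move=> mG; apply: measurable_funM => //; apply: measurable_funD => //.
exact: measurable_expsum.
Qed.

Lemma softmax_ge0 G lam a w : 0 < lam -> 1 <= a -> 0 <= softmax G lam a w.
Proof.
move=> l0 a1; rewrite /softmax; apply: mulr_ge0; first by rewrite invr_ge0 ltW.
by apply: addr_ge0; [rewrite subr_ge0|exact: expsum_ge0].
Qed.

Lemma le_softmax G lam a u w : 0 < lam -> `|G u w| <= softmax G lam a w.
Proof.
by move=> l0; rewrite /softmax mulrC ler_pdivlMr// mulrC le_expsum// ltW.
Qed.

(** The condition on [a] makes the integral of [expsum] at most 1, which cancels the [-1] in
    [softmax]. With the least such [a] this is the usual maximal inequality
    [ln (2 * #|U| * E) / lam]. *)
Lemma integral_softmax (P : probability T R) G lam a E :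
  (forall u, measurable_fun setT (G u)) -> 0 < lam -> 1 <= a ->
  (forall u, (\int[P]_w (expR (lam * G u w))%:E <= E%:E)%E) ->
  (forall u, (\int[P]_w (expR (- lam * G u w))%:E <= E%:E)%E) ->
  #|U|%:R * 2 * E <= expR a ->
  (\int[P]_w (softmax G lam a w)%:E <= (a / lam)%:E)%E.
Proof.
move=> mG l0 a1 GE GE' UE.
have ms : measurable_fun setT (fun w => (expsum G lam a w)%:E).
  by apply/measurable_EFinP; exact: measurable_expsum.
have s0 w : (0 <= (expsum G lam a w)%:E)%E by rewrite lee_fin expsum_ge0.
have a0 : (0 <= (a - 1)%:E)%E by rewrite lee_fin subr_ge0.
under eq_integral do rewrite /softmax EFinM EFinD.
rewrite ge0_integralZl_EFin//; last 3 first.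
- by move=> w _; rewrite adde_ge0.
- exact: emeasurable_funD.
- by rewrite invr_ge0 ltW.
rewrite ge0_integralD//.
rewrite integral_cst// [X in (_ * X + _)%E](_ : _ = 1%E);
  last exact: probability_setT.
rewrite mule1 mulrC EFinM; apply: lee_wpmul2l; first by rewrite lee_fin invr_ge0 ltW.
apply: (@le_trans _ _ ((a - 1)%:E + 1%:E)%E); last by rewrite -EFinD subrK.
rewrite leeD2l// (le_trans (integral_expsum a mG GE GE'))// lee_fin.
by rewrite ler_pdivrMr ?expR_gt0// mul1r.
Qed.

End softmax.

(** * Chaining over dyadic grids *)

Section grid.
Context (R : realType) (I : finType).

Definition in_box (x : I -> R) := forall i, -1 <= x i <= 1.

Definition grid (M : nat) (u : {ffun I -> 'I_(2 * M).+1}) (i : I) : R :=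
  (u i)%:R / M%:R - 1.

(** Rounds each coordinate down to the mesh [1/M]. Inside the box the truncation is at most [2 * M],
    so the default value of [inord] does not occur there. *)
Definition grid_round (M : nat) (x : I -> R) : {ffun I -> 'I_(2 * M).+1} :=
  [ffun i => inord (Num.truncn ((x i + 1) * M%:R))].

Lemma grid_in_box M u : (0 < M)%N -> in_box (@grid M u).
Proof.
move=> M0 i; rewrite /grid; have M0' : 0 < M%:R :> R by rewrite ltr0n.
have : (u i <= 2 * M)%N by rewrite -ltnS.
rewrite -(ler_nat R) natrM => uM.
have : (u i)%:R / M%:R <= 2 :> R by rewrite ler_pdivrMr.
have : 0 <= (u i)%:R / M%:R :> R by rewrite divr_ge0.
by lra.
Qed.

Lemma grid_roundP M x i : (0 < M)%N -> in_box x ->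
  `|grid (grid_round M x) i - x i| <= M%:R^-1.
Proof.
move=> M0 xb; rewrite /grid ffunE; have M0' : 0 < M%:R :> R by rewrite ltr0n.
have M0w : 0 <= M%:R :> R by exact: ltW.
set t := (x i + 1) * M%:R; have /andP[x1 x2] := xb i.
have t0 : 0 <= t by rewrite mulr_ge0//; lra.
have t2 : (Num.truncn t < (2 * M).+1)%N.
  rewrite truncn_lt_nat// (@le_lt_trans _ _ (2 * M)%:R)//.
    by rewrite natrM ler_wpM2r//; lra.
  by rewrite ltr_nat.
rewrite inordK//; have /andP[h1 h2] := truncn_itv t0.
have -> : x i = t / M%:R - 1 by rewrite /t mulfK ?gt_eqF// addrK.
rewrite (_ : _ - _ = ((Num.truncn t)%:R - t) * M%:R^-1); last by ring.
rewrite normrM [X in _ * X]ger0_norm ?invr_ge0//.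
rewrite ler_piMl ?invr_ge0//; move: h2; rewrite -natr1 => h2.
by rewrite ler_norml; apply/andP; split; lra.
Qed.

Lemma card_grid M : #|{ffun I -> 'I_(2 * M).+1}| = ((2 * M).+1 ^ #|I|)%N.
Proof. by rewrite card_ffun card_ord. Qed.

End grid.
Arguments grid {R I M} u i.

Lemma expR1_ge2 (R : realType) : 2 <= expR 1 :> R.
Proof. by have := expR_ge1Dx (1 : R); lra. Qed.

Lemma natr_exp2_le_expR (R : realType) n : (2 ^ n)%:R <= expR n%:R :> R.
Proof.
rewrite natrX -[in leRHS](mulr1 n%:R) expRM_natl lerXn2r ?nnegrE ?expR_ge0//.
exact: expR1_ge2.
Qed.

(** Total cost of the chain: the numerator is the affine growth of [level], the denominator the
    dyadic growth of [scale]. *)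
Lemma sum_affine_geometric (R : realType) (A D : R) n :
  \sum_(l < n) (A + D * l%:R) / (2 ^ l)%:R =
  2 * A + 2 * D - (2 * A + 2 * D + 2 * D * n%:R) / (2 ^ n)%:R.
Proof.
elim: n => [|n IH]; first by rewrite big_ord0 expn0; field.
rewrite big_ord_recr/= IH expnS natrM -natr1.
by field; rewrite pnatr_eq0 expn_eq0.
Qed.

Section chaining.
Context d d' (T : measurableType d) (T' : measurableType d') (R : realType)
  (P : probability T R) (S : nat -> {RV P >-> T'}) (PS : probability T' R).
Hypothesis iidS : iid_with_law S PS.
Context (I : finType) (F : (I -> R) -> T' -> R) (K : R).
Hypothesis K0 : 0 <= K.
Hypothesis mF : forall x, measurable_fun setT (F x).
Hypothesis F_bound : forall x y, in_box x -> `|F x y| <= K.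
Hypothesis F_lip : forall (x x' : I -> R) (e : R) y, in_box x -> in_box x' ->
  (forall i, `|x i - x' i| <= e) -> `|F x y - F x' y| <= K * e.

Let D : R := #|I|%:R.
Let dev := deviation S PS.

Let mdev f n : measurable_fun setT f -> measurable_fun setT (dev f n).
Proof. exact: measurable_deviation. Qed.

Let mFB x x' : measurable_fun setT (fun y => F x y - F x' y).
Proof. exact: measurable_funB. Qed.

Lemma deviation_lip (x x' : I -> R) (e : R) n w : (0 < n)%N -> in_box x -> in_box x' ->
  (forall i, `|x i - x' i| <= e) ->
  `|dev (F x) n w - dev (F x') n w| <= 2 * (K * e).
Proof.
move=> n0 xb x'b xx'.
have fb y := F_bound y xb; have fb' y := F_bound y x'b.
rewrite /dev -(deviationB S PS n w (mF x) fb (mF x') fb').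
by apply: deviation_bound => // y; exact: F_lip.
Qed.

Let step n l (u : {ffun I -> 'I_(2 * 2 ^ l.+1).+1}) : T -> R :=
  let x : I -> R := grid u in
  dev (fun y => F x y - F (@grid R I (2 ^ l) (grid_round (2 ^ l) x)) y) n.

(** Exponential parameter at level [l]. The increments arriving there are bounded by
    [b = 2 * K / 2 ^ l], so the exponent [12 * t ^+ 2 * b ^+ 2 / n] of [expR_deviation] becomes
    [48 * K ^+ 2], free of [n] and [l]. *)
Let scale n l : R := Num.sqrt n%:R * (2 ^ l)%:R.
(** Bounds the logarithm of what [integral_softmax] asks for: 1 for the two signs, [D * l.+2] for
    the grid points, at most [2 ^ l.+2] per coordinate, and [48 * K ^+ 2] for the moment. Powers of
    2 are absorbed by [2 <= expR 1]. *)
Let level l : R := 1 + D * l.+2%:R + 48 * K ^+ 2.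

Let scale_gt0 n l : (0 < n)%N -> 0 < scale n l.
Proof.
by move=> n0; rewrite mulr_gt0 ?sqrtr_gt0 ?ltr0n// expn_gt0.
Qed.

Let level_ge1 l : 1 <= level l.
Proof.
rewrite /level -addrA lerDl addr_ge0// mulr_ge0// ?sqr_ge0//.
Qed.

Let card_level l :
  #|{ffun I -> 'I_(2 * 2 ^ l).+1}|%:R * 2 * expR (48 * K ^+ 2) <=
  expR (level l) :> R.
Proof.
rewrite /level expRD ler_wpM2r ?expR_ge0// card_grid.
apply: (@le_trans _ _ (2 ^ (1 + #|I| * l.+2))%:R).
  rewrite -(natrM _ _ 2) ler_nat addnC expnD expn1 leq_mul2r/=.
  rewrite [(#|I| * _)%N]mulnC expnM.
  case: #|I| => [|c]; first by rewrite !expn0.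
  by rewrite leq_exp2r// !expnS; have := expn_gt0 2 l; lia.
apply: le_trans (natr_exp2_le_expR _ _) _.
by rewrite ler_expR natrD natrM.
Qed.

Let integral_level0 n : (0 < n)%N ->
  (\int[P]_w (softmax (fun u => dev (F (@grid R I (2 ^ 0) u)) n)
     (scale n 0) (level 0) w)%:E <= (level 0 / scale n 0)%:E)%E.
Proof.
move=> n0; have n0' : 0 < n%:R :> R by rewrite ltr0n.
have E t u : t ^+ 2 = n%:R ->
    (\int[P]_w (expR (t * dev (F (@grid R I (2 ^ 0) u)) n w))%:E <=
     (expR (48 * K ^+ 2))%:E)%E.
  move=> tn; apply: le_trans (expR_deviation iidS t n0 (mF _) _) _.
    by move=> y; apply: F_bound; exact: grid_in_box.
  rewrite lee_fin ler_expR tn.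
  have -> : 12 * n%:R * K ^+ 2 / n%:R = 12 * K ^+ 2 by field; rewrite gt_eqF.
  by rewrite ler_wpM2r ?sqr_ge0//; lra.
have s2 : scale n 0 ^+ 2 = n%:R by rewrite /scale mulr1 sqr_sqrtr// ltW.
apply: (integral_softmax _ _ _ _ _ (card_level 0)) => //.
- by move=> u; exact: mdev.
- exact: scale_gt0.
- by move=> u; exact: E.
- by move=> u; apply: E; rewrite sqrrN.
Qed.

Let integral_step n l : (0 < n)%N ->
  (\int[P]_w (softmax (@step n l) (scale n l.+1) (level l.+1) w)%:E <=
   (level l.+1 / scale n l.+1)%:E)%E.
Proof.
move=> n0; have n0' : 0 < n%:R :> R by rewrite ltr0n.
have l0 : 0 < (2 ^ l)%:R :> R by rewrite ltr0n expn_gt0.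
have E t u : t ^+ 2 = n%:R * (2 ^ l.+1)%:R ^+ 2 ->
    (\int[P]_w (expR (t * @step n l u w))%:E <= (expR (48 * K ^+ 2))%:E)%E.
  move=> tn; apply: le_trans (expR_deviation iidS t n0 (mFB _ _)
    (_ : forall y, _ <= K / (2 ^ l)%:R)) _.
    move=> y; apply: F_lip => [||i]; do ?[exact: grid_in_box].
      by apply: grid_in_box; rewrite expn_gt0.
      by apply: grid_in_box; rewrite expn_gt0.
    rewrite distrC grid_roundP// ?expn_gt0//.
    by apply: grid_in_box; rewrite expn_gt0.
  rewrite lee_fin ler_expR tn expnS natrM le_eqVlt; apply/orP; left; apply/eqP.
  by field; rewrite !gt_eqF.
have s2 : scale n l.+1 ^+ 2 = n%:R * (2 ^ l.+1)%:R ^+ 2.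
  by rewrite /scale exprMn sqr_sqrtr// ltW.
apply: (integral_softmax _ _ _ _ _ (card_level l.+1)) => //.
- by move=> u; exact: mdev.
- exact: scale_gt0.
- by move=> u; exact: E.
- by move=> u; apply: E; rewrite sqrrN.
Qed.

Let chain n L w :=
  softmax (fun u => dev (F (@grid R I (2 ^ 0) u)) n) (scale n 0) (level 0) w +
  \sum_(l < L) softmax (@step n l) (scale n l.+1) (level l.+1) w.

(** Telescoping: a point of the finest grid is rounded successively to the coarser ones, and each
    difference is an instance of [step]. The majorant no longer depends on the point. *)
Let le_chain n L (u : {ffun I -> 'I_(2 * 2 ^ L).+1}) w : (0 < n)%N ->
  `|dev (F (grid u)) n w| <= chain n L w.
Proof.
move=> n0; elim: L u => [|L IH] u.
  by rewrite /chain big_ord0 addr0 (le_softmax _ _ u)// scale_gt0.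
have gb k v : in_box (@grid R I (2 ^ k) v).
  by apply: grid_in_box; rewrite expn_gt0.
rewrite /chain big_ord_recr/= addrA.
set v := grid_round (2 ^ L) (@grid R I (2 ^ L.+1) u).
rewrite -[dev _ _ _](subrK (dev (F (@grid R I (2 ^ L) v)) n w)).
apply: le_trans (ler_normD _ _) _; rewrite [leRHS]addrC; apply: lerD; last first.
  exact: IH.
have fb y := F_bound y (gb L.+1 u); have fb' y := F_bound y (gb L v).
rewrite /dev -(deviationB S PS n w (mF _) fb (mF _) fb').
by apply: (@le_softmax _ _ _ _ (@step n L) _ _ u); exact: scale_gt0.
Qed.

(** The geometric sum with [A = 1 + 2 * D + 48 * K ^+ 2] is at most [2 * A + 2 * D]; the final
    [2 * K] pays for rounding to the finest grid. *)
Definition chaining_const := 2 + 6 * D + 96 * K ^+ 2 + 2 * K.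

Lemma uniform_deviation_expectation n : (0 < n)%N ->
  exists M : T -> R, [/\ measurable_fun setT M, forall w, 0 <= M w,
    forall x w, in_box x -> `|deviation S PS (F x) n w| <= M w &
    (\int[P]_w (M w)%:E <= (chaining_const / Num.sqrt n%:R)%:E)%E].
Proof.
move=> n0; have n0' : 0 < n%:R :> R by rewrite ltr0n.
have s0 : 0 < Num.sqrt n%:R :> R by rewrite sqrtr_gt0.
have p0 : 0 < (2 ^ n)%:R :> R by rewrite ltr0n expn_gt0.
have m0 : measurable_fun setT (softmax (fun u => dev (F (@grid R I (2 ^ 0) u)) n)
    (scale n 0) (level 0)).
  by apply: measurable_softmax => u; exact: mdev.
have m1 l : measurable_fun setT (softmax (@step n l) (scale n l.+1) (level l.+1)).
  by apply: measurable_softmax => u; exact: mdev.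
have ge0 w : 0 <= softmax (fun u => dev (F (@grid R I (2 ^ 0) u)) n)
    (scale n 0) (level 0) w by apply: softmax_ge0 => //; exact: scale_gt0.
have ge1 l w : 0 <= softmax (@step n l) (scale n l.+1) (level l.+1) w.
  by apply: softmax_ge0 => //; exact: scale_gt0.
have mchain : measurable_fun setT (chain n n).
  by apply: measurable_funD => //; apply: measurable_sum => l; exact: m1.
have chain0 w : 0 <= chain n n w.
  by rewrite /chain addr_ge0// sumr_ge0.
have err0 : 0 <= 2 * (K / (2 ^ n)%:R) by rewrite mulr_ge0// divr_ge0// ltW.
(* Depth [n] is enough: rounding at mesh [2 ^- n] costs [2 * K / 2 ^ n], and [2 ^ n] exceeds
   [sqrt n]. *)
exists (fun w => chain n n w + 2 * (K / (2 ^ n)%:R)); split.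
- exact: measurable_funD.
- by move=> w; rewrite addr_ge0.
- move=> x w xb; set u := grid_round (2 ^ n) x.
  have ub : in_box (@grid R I (2 ^ n) u) by apply: grid_in_box; rewrite expn_gt0.
  rewrite -[deviation _ _ _ _ _](subrK (dev (F (@grid R I (2 ^ n) u)) n w)).
  rewrite addrC (le_trans (ler_normD _ _))// lerD//; first exact: le_chain.
  apply: deviation_lip => // i; rewrite distrC grid_roundP ?expn_gt0//.
have -> : (\int[P]_w (chain n n w + 2 * (K / (2 ^ n)%:R))%:E =
    \int[P]_w (softmax (fun u => dev (F (@grid R I (2 ^ 0) u)) n)
      (scale n 0) (level 0) w)%:E +
    \sum_(l < n) \int[P]_w (softmax (@step n l) (scale n l.+1) (level l.+1) w)%:E +
    (2 * (K / (2 ^ n)%:R))%:E)%E.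
  under eq_integral do rewrite EFinD.
  rewrite ge0_integralD//; last 2 first.
  - by move=> w _; rewrite lee_fin.
  - exact/measurable_EFinP.
  rewrite integral_cst// [X in (_ * X)%E](_ : _ = 1%E) ?mule1;
    last exact: probability_setT.
  congr (_ + _)%E; under eq_integral do rewrite /chain EFinD -sumEFin.
  have ms l : measurable_fun setT
      (fun w => (softmax (@step n l) (scale n l.+1) (level l.+1) w)%:E).
    exact/measurable_EFinP.
  rewrite ge0_integralD//; last 4 first.
  - by move=> w _; rewrite lee_fin.
  - exact/measurable_EFinP.
  - by move=> w _; apply: sume_ge0 => l _; rewrite lee_fin.
  - by apply: emeasurable_sum => l; exact: ms.
  congr (_ + _)%E; rewrite ge0_integral_sum//.
  by move=> l w _; rewrite lee_fin.
apply: (@le_trans _ _ ((level 0 / scale n 0)%:E +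
    \sum_(l < n) (level l.+1 / scale n l.+1)%:E + (2 * (K / (2 ^ n)%:R))%:E)%E).
  rewrite leeD2r// leeD//; first exact: integral_level0.
  by apply: lee_sum => l _; exact: integral_step.
rewrite sumEFin -!EFinD lee_fin.
have -> : level 0 / scale n 0 + \sum_(l < n) level l.+1 / scale n l.+1 =
    \sum_(l < n.+1) level l / scale n l by rewrite big_ord_recl.
have -> : \sum_(l < n.+1) level l / scale n l = (Num.sqrt n%:R)^-1 *
    \sum_(l < n.+1) (1 + 2 * D + 48 * K ^+ 2 + D * l%:R) / (2 ^ l)%:R.
  rewrite mulr_sumr; apply: eq_bigr => l _; rewrite /scale /level invfM.
  by rewrite -addn2 natrD; ring.
rewrite sum_affine_geometric /chaining_const -/D.
set i := (Num.sqrt n%:R)^-1; set q := (2 ^ n)%:R^-1.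
have i0 : 0 <= i by rewrite invr_ge0 ltW.
have q0 : 0 <= q by rewrite invr_ge0 ltW.
have qi : q <= i.
  rewrite /q /i lef_pV2 ?posrE//.
  rewrite (@le_trans _ _ n%:R)//; last by rewrite ler_nat ltnW// ltn_expl.
  have s2 : Num.sqrt n%:R ^+ 2 = n%:R :> R by rewrite sqr_sqrtr// ltW.
  have n1 : 1 <= n%:R :> R by rewrite ler1n.
  by rewrite -[leRHS]s2; nra.
set A := 1 + 2 * D + 48 * K ^+ 2.
have D0 : 0 <= D by [].
have A0 : 0 <= 2 * A + 2 * D + 2 * D * n.+1%:R.
  by rewrite /A !addr_ge0// !mulr_ge0// ?sqr_ge0// !addr_ge0// mulr_ge0// sqr_ge0.
(* The remainder subtracted in the closed form of the sum is nonnegative and is dropped. *)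
have : 0 <= i * ((2 * A + 2 * D + 2 * D * n.+1%:R) / (2 ^ n.+1)%:R).
  by rewrite mulr_ge0// divr_ge0.
have : K * q <= K * i by rewrite ler_wpM2l.
rewrite /A mulrBr; set z := i * (_ / _); lra.
Qed.

(** * Almost sure rate from a single grid *)

Let ae_level n : R := (2 * D + 3 + 12 * K ^+ 2) * ln n%:R.
Let ae_scale n : R := Num.sqrt n%:R * Num.sqrt (ln n%:R).
Let ae_sum n (w : T) : R :=
  expsum (fun u => dev (F (@grid R I n u)) n) (ae_scale n) (ae_level n) w.

Let ln_ge1 n : (4 <= n)%N -> 1 <= ln n%:R :> R.
Proof.
move=> n4; have n0 : 0 < n%:R :> R by rewrite ltr0n; lia.
rewrite -ler_expR lnK ?posrE//.
have e4 : expR 1 <= 4 :> R.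
  have h := expR_ge1Dx (- (1 / 2) : R).
  have e : expR 1 * expR (- (1 / 2)) ^+ 2 = 1 :> R.
    by rewrite expr2 -!expRD -[RHS]expR0; congr expR; field.
  have y4 : 1 / 4 <= expR (- (1 / 2) : R) ^+ 2 by nra.
  have : expR 1 * (1 / 4) <= 1 :> R by rewrite -[leRHS]e ler_wpM2l// expR_ge0.
  by lra.
by rewrite (le_trans e4)// ler_nat.
Qed.

Let integral_ae_sum n : (4 <= n)%N ->
  (\int[P]_w (ae_sum n w)%:E <= ((n%:R ^+ 2)^-1)%:E)%E.
Proof.
move=> n4; have n0 : (0 < n)%N by lia.
have n0' : 0 < n%:R :> R by rewrite ltr0n.
have L1 := ln_ge1 n4; set L : R := ln n%:R in L1 *.
have L0 : 0 <= L by rewrite (le_trans _ L1).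
have E t u : t ^+ 2 = n%:R * L ->
    (\int[P]_w (expR (t * dev (F (@grid R I n u)) n w))%:E <=
     (expR (12 * K ^+ 2 * L))%:E)%E.
  move=> tn; apply: le_trans (expR_deviation iidS t n0 (mF _) _) _.
    by move=> y; apply: F_bound; exact: grid_in_box.
  rewrite lee_fin ler_expR tn.
  have -> : 12 * (n%:R * L) * K ^+ 2 / n%:R = 12 * K ^+ 2 * L.
    by field; rewrite gt_eqF.
  exact: lexx.
have s2 : ae_scale n ^+ 2 = n%:R * L.
  by rewrite /ae_scale exprMn !sqr_sqrtr// ltW.
apply: le_trans (integral_expsum _ _ (fun u => E _ u s2) _) _.
- by move=> u; exact: mdev.
- by move=> u; apply: E; rewrite sqrrN.
rewrite lee_fin ler_pdivrMr ?expR_gt0//.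
have nE : n%:R = expR L :> R by rewrite /L lnK.
(* For [n >= 4], [2 * (2 * n + 1) ^ #|I| <= n ^ (2 * #|I| + 1)], which the first term absorbs; the
   last one absorbs the exponential moment, and [2 * L] leaves the summable [n ^- 2]. *)
have -> : ae_level n = (2 * #|I| + 1)%:R * L + 2 * L + 12 * K ^+ 2 * L.
  by rewrite /ae_level -/L natrD natrM /D; ring.
rewrite 2!expRD 2!expRM_natl -nE.
set e := expR (12 * _ * _); have e0 : 0 <= e by exact: expR_ge0.
have -> : n%:R ^- 2 * (n%:R ^+ (2 * #|I| + 1) * n%:R ^+ 2 * e) =
    n%:R ^+ (2 * #|I| + 1) * e by field; rewrite gt_eqF.
rewrite ler_wpM2r//.
rewrite card_grid -(natrM _ _ 2) -natrX ler_nat expnD expn1 leq_mul//; last by lia.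
rewrite expnM; case: #|I| => [|c]; first by rewrite !expn0.
by rewrite leq_exp2r//; nia.
Qed.

Lemma uniform_deviation_ae : exists c : R,
  {ae P, forall w, \forall n \near \oo, forall x, in_box x ->
    `|deviation S PS (F x) n w| <= c * (Num.sqrt (ln n%:R) / Num.sqrt n%:R)}.
Proof.
(* [ae_level n / ae_scale n] yields the first three terms; [2 * K] covers rounding to mesh [1/n]. *)
exists (2 * D + 3 + 12 * K ^+ 2 + 2 * K).
pose A n := [set w | 1 <= ae_sum n.+4 w].
have msum n : measurable_fun setT (ae_sum n).
  by apply: measurable_expsum => u; exact: mdev.
have mA n : measurable (A n).
  rewrite (_ : A n = setT `&` ae_sum n.+4 @^-1` `[1, +oo[%classic).
    exact: msum.
  by rewrite setTI; apply/seteqP; split => w /=; rewrite /A/= in_itv/= andbT.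
have PA n : (P (A n) <= ((n.+4%:R ^+ 2)^-1)%:E)%E.
  apply: le_trans (integral_ae_sum (_ : (4 <= n.+4)%N)) => //.
  (* Markov's inequality at threshold 1. *)
  have := @le_integral_abse _ _ _ P setT measurableT
    (fun w => (ae_sum n.+4 w)%:E) 1.
  rewrite mul1e setTI => h.
  have -> : (\int[P]_w (ae_sum n.+4 w)%:E = \int[P]_w `|(ae_sum n.+4 w)%:E|)%E.
    by apply: eq_integral => w _; rewrite gee0_abs// lee_fin expsum_ge0.
  apply: le_trans (h _ _) => //; last exact/measurable_EFinP.
  rewrite le_measure ?inE//.
    rewrite (_ : [set _ | _] = A n)//; apply/seteqP; split => w /=.
      by rewrite lee_fin ger0_norm ?expsum_ge0.
    by rewrite lee_fin ger0_norm ?expsum_ge0.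
  by move=> w /=; rewrite /A/= lee_fin ger0_norm ?expsum_ge0.
have sumA : (\sum_(n <oo) P (A n) < +oo)%E.
  apply: (@le_lt_trans _ _ 1%:E); last exact: ltry.
  apply: lime_le; first exact: is_cvg_nneseries.
  apply: nearW => N.
  (* Telescoping bound on the partial sums, from [1 / (t + 1) ^+ 2 <= 1 / t - 1 / (t + 1)]. *)
  apply: (@le_trans _ _ (1 - N.+3%:R^-1)%:E); last first.
    by rewrite lee_fin gerBl invr_ge0.
  elim: N => [|N IH].
    by rewrite big_nil lee_fin subr_ge0 invf_le1// ler1n.
  rewrite big_nat_recr//=.
  apply: le_trans (leeD IH (PA N)) _; rewrite -EFinD lee_fin.
  rewrite -[N.+4%:R]natr1; set t : R := N.+3%:R.
  have t0 : 0 < t by rewrite ltr0n.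
  rewrite -subr_ge0.
  have -> : 1 - (t + 1)^-1 - (1 - t^-1 + ((t + 1) ^+ 2)^-1) =
     (t * (t + 1) ^+ 2)^-1 by field; rewrite !gt_eqF// ltr_wpDr.
  by rewrite invr_ge0; apply: mulr_ge0; [exact: ltW|exact: sqr_ge0].
have limA := lim_sup_set_cvg0 mA sumA.
exists (lim_sup_set A); split => //.
  by apply: bigcap_measurable => // n _; apply: bigcup_measurable.
move=> w /= nw N _; apply: contrapT => wN; apply: nw.
exists (N + 4)%N => // n /= Nn x xb.
have n4 : (4 <= n)%N by lia.
have n0 : (0 < n)%N by lia.
have n0' : 0 < n%:R :> R by rewrite ltr0n.
have L1 := ln_ge1 n4; set L : R := ln n%:R in L1 *.
have nA : ae_sum n w < 1.
  rewrite ltNge; apply/negP => h; apply: wN; exists (n - 4)%N => /=; first lia.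
  by rewrite /A/= (_ : (n - 4).+4 = n)//; lia.
set u := grid_round n x.
have sL : 0 < Num.sqrt L by rewrite sqrtr_gt0 (lt_le_trans _ L1).
have sn : 0 < Num.sqrt n%:R :> R by rewrite sqrtr_gt0.
have scale0 : 0 < ae_scale n by rewrite mulr_gt0.
have sL2 : Num.sqrt L ^+ 2 = L by rewrite sqr_sqrtr// (le_trans _ L1).
have sn2 : Num.sqrt n%:R ^+ 2 = n%:R :> R by rewrite sqr_sqrtr// ltW.
rewrite -[deviation _ _ _ _ _](subrK (dev (F (@grid R I n u)) n w)).
apply: le_trans (ler_normD _ _) _; rewrite mulrDl addrC; apply: lerD.
  have := @le_expsum _ _ _ _ (fun u => dev (F (@grid R I n u)) n) _
    (ae_level n) u w (ltW scale0).
  rewrite -/(ae_sum n w) => h.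
  have {}h : ae_scale n * `|dev (F (grid u)) n w| <= ae_level n by lra.
  move: h; rewrite mulrC -ler_pdivlMr// => /le_trans; apply.
  rewrite /ae_level /ae_scale -/L -[X in _ * X / _]sL2 le_eqVlt; apply/orP; left.
  by apply/eqP; field; rewrite !gt_eqF.
apply: (@le_trans _ _ (2 * (K * n%:R^-1))).
  apply: deviation_lip => //; first exact: grid_in_box.
  by move=> i; rewrite distrC grid_roundP.
rewrite mulrA ler_wpM2l ?mulr_ge0//.
have sn1 : 1 <= Num.sqrt n%:R :> R.
  by rewrite -[leLHS]sqrtr1; apply: ler_wsqrtr; rewrite ler1n.
have sL1 : 1 <= Num.sqrt L by rewrite -[leLHS]sqrtr1; exact: ler_wsqrtr.
rewrite -[X in X^-1]sn2 expr2 invfM.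
apply: ler_wpM2r; first by rewrite invr_ge0 ltW.
by apply: le_trans sL1; rewrite invf_le1.
Qed.

End chaining.

(** * Cholesky factors *)

Section cholesky.
Context (R : realType).

(** Induction on the size through the Schur complement [B] of the corner entry [a]: the first column
    of the factor is [sqrt a] above [b / sqrt a], and the rest is a factor of [B]. *)
Lemma is_cholesky_exists (m : nat) (A : 'M[R]_m) :
  sym_posdef A -> exists L, is_cholesky A L.
Proof.
elim: m A => [|m IH] A [Asym Apos].
  exists 0; split; first by apply/is_trig_mxP => -[].
  - by case.
  - by apply/matrixP => -[].
rewrite -[m.+1]/(1 + m)%N in A Asym Apos *.
pose a := A 0 0; pose b := dlsubmx A; pose C := drsubmx A.
have AE : A = block_mx a%:M b^T b C.
  rewrite -[LHS](submxK A); congr block_mx.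
    by rewrite [LHS]mx11_scalar; congr (_%:M); rewrite !mxE; congr (A _ _);
      apply/val_inj.
  by rewrite /b trmx_dlsub Asym.
have Csym : C^T = C by rewrite /C trmx_drsub Asym.
have a0 : 0 < a.
  pose e : 'cV[R]_(1 + m) := delta_mx 0 0.
  have -> : a = (e^T *m A *m e) 0 0 by rewrite trmx_delta -rowE -colE !mxE.
  apply: Apos; apply/eqP => /matrixP/(_ 0 0); rewrite !mxE/= => /eqP.
  by rewrite oner_eq0.
pose B := C - a^-1 *: (b *m b^T).
have [L' [trigL' posL' BL']] : exists L, is_cholesky B L.
  apply: IH; split.
    by rewrite linearB linearZ/= trmx_mul trmxK Csym.
  (* The first coordinate [- (s / a)] minimises the quadratic form of [A] over vectors with tail
     [y], and the minimum is the form of [B] at [y]. *)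
  move=> y y0; pose s := (b^T *m y) 0 0.
  pose x : 'cV[R]_(1 + m) := col_mx (- (s / a))%:M y.
  have bty : b^T *m y = s%:M by rewrite [LHS]mx11_scalar.
  have ytb : y^T *m b = s%:M by rewrite -[LHS]trmxK trmx_mul trmxK bty tr_scalar_mx.
  have x0 : x != 0.
    apply: contraNneq y0 => /eqP; rewrite -col_mx0 => /eqP/eq_col_mx[_ ->].
    by [].
  suff <- : (x^T *m A *m x) 0 0 = (y^T *m B *m y) 0 0 by exact: Apos.
  rewrite AE /x tr_col_mx mul_row_block mul_row_col tr_scalar_mx.
  rewrite /B !mulmxDl -!mulmxA bty mulmxBl mulmxBr -scalemxAl -scalemxAr.
  rewrite !mulmxA ytb -(mulmxA _ b^T) bty -!scalar_mxM.
  rewrite !mxE/= !mulr1n; field.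
  by rewrite gt_eqF.
pose sa := Num.sqrt a; have sa0 : 0 < sa by rewrite sqrtr_gt0.
have sa2 : sa * sa = a by rewrite -expr2 sqr_sqrtr// ltW.
exists (block_mx sa%:M 0 (sa^-1 *: b) L'); split.
- rewrite is_trig_block_mx// eqxx trigL' andbT /=.
  by apply/is_trig_mxP => i j; rewrite !ord1.
- move=> i; case: (splitP i) => [j ij|j ij].
    have -> : i = lshift m j by apply/val_inj.
    by rewrite block_mxEul ord1 mxE.
  have -> : i = rshift 1 j by apply/val_inj.
  by rewrite block_mxEdr.
rewrite tr_block_mx mulmx_block !trmx0 !mulmx0 !mul0mx !addr0 tr_scalar_mx.
rewrite -scalar_mxM sa2 mul_scalar_mx mul_mx_scalar linearZ/= !scalerA.
rewrite mulfV ?gt_eqF// !scale1r -scalemxAl -scalemxAr scalerA -BL' /B.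
by rewrite -invfM sa2 [_ *: _ + _]addrC subrK.
Qed.

Lemma choleskyP (m : nat) (s : spd R m) : is_cholesky s (cholesky s).
Proof.
rewrite /cholesky; case: xgetP => [L _ //|noL].
have := valP s => /asboolP /is_cholesky_exists[L hL].
by have := noL L.
Qed.

Section cholesky_entries.
Context (m : nat) (s : spd R m).
Let L := cholesky s.

Let mulLLt i j : (s : 'M[R]_m) i j = \sum_(k < m | (k <= j)%N) L i k * L j k.
Proof.
have [/is_trig_mxP trigL _ ->] := choleskyP s.
rewrite mxE (bigID (fun k : 'I_m => (k <= j)%N))/= [X in _ + X]big1 ?addr0.
  by apply: eq_bigr => k _; rewrite mxE.
by move=> k; rewrite -ltnNge => jk; rewrite !mxE (trigL j k jk) mulr0.
Qed.

Let mulLLt' i j : (s : 'M[R]_m) i j =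
  \sum_(k < m | (k < j)%N) L i k * L j k + L i j * L j j.
Proof.
rewrite mulLLt (bigD1 j)//= addrC; congr (_ + _).
by apply: eq_bigl => k; rewrite ltn_neqAle andbC.
Qed.

Lemma cholesky_diag_gt0 j : 0 < L j j.
Proof. by have [_ + _] := choleskyP s; exact. Qed.

(** With [cholesky_lower], this is the column-by-column Cholesky algorithm: only columns before [j],
    and the pivot [L j j], occur on the right. Measurability follows by induction on the column. *)
Lemma cholesky_diag j :
  L j j = Num.sqrt ((s : 'M[R]_m) j j - \sum_(k < m | (k < j)%N) L j k ^+ 2).
Proof.
rewrite mulLLt'; under [X in _ = Num.sqrt (_ - X)]eq_bigr do rewrite expr2.
by rewrite addrAC subrr add0r -expr2 sqrtr_sqr ger0_norm// ltW// cholesky_diag_gt0.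
Qed.

Lemma cholesky_lower i j :
  L i j = ((s : 'M[R]_m) i j - \sum_(k < m | (k < j)%N) L i k * L j k) * (L j j)^-1.
Proof.
by rewrite mulLLt' [X in X - _]addrC addrK mulfK// gt_eqF// cholesky_diag_gt0.
Qed.

End cholesky_entries.

Lemma measurable_spd_entry (m : nat) (i j : 'I_m) :
  measurable_fun setT (fun s : spd R m => (s : 'M[R]_m) i j).
Proof.
apply: (measurability _ (RGenOpens.measurableE R)) => _ [_ [a [b ->] <-]].
rewrite setTI; apply: sub_sigma_algebra.
have cf : continuous (fun s : spd R m => (s : 'M[R]_m) i j).
  move=> s; apply: (@continuous_comp _ _ _ (@spd_mx R m) (fun M : 'M[R]_m => M i j)).
    exact: initial_continuous.
  exact: coord_continuous.
by move/continuousP : cf; apply; exact: interval_open.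
Qed.

Lemma measurable_cholesky (m : nat) (i j : 'I_m) :
  measurable_fun setT (fun s : spd R m => cholesky s i j).
Proof.
have [n] := ubnP (j : nat); elim: n i j => // n IH i j jn.
have IHk (l k : 'I_m) : (k < j)%N ->
    measurable_fun setT (fun s : spd R m => cholesky s l k).
  by move=> kj; apply: IH; exact: leq_trans kj _.
have mdiag : measurable_fun setT (fun s : spd R m => cholesky s j j).
  under eq_fun do rewrite cholesky_diag.
  apply: (measurableT_comp (continuous_measurable_fun (@sqrt_continuous R))).
  apply: measurable_funB; first exact: measurable_spd_entry.
  under eq_fun do rewrite big_mkcond.
  apply: measurable_sum => k; case: (boolP (k < j)%N) => kj //=.
  by apply: measurable_funX; exact: IHk.
under eq_fun do rewrite cholesky_lower.
apply: measurable_funM.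
  apply: measurable_funB; first exact: measurable_spd_entry.
  under eq_fun do rewrite big_mkcond.
  apply: measurable_sum => k; case: (boolP (k < j)%N) => kj //=.
  by apply: measurable_funM; exact: IHk.
(* On the positive pivots, inversion agrees with the measurable power function of exponent -1. *)
rewrite (_ : (fun s => _) = (fun s : spd R m => cholesky s j j `^ (-1))).
  exact: (measurableT_comp (measurable_powR _)).
by apply/funext => s; rewrite powR_inv1// ltW// cholesky_diag_gt0.
Qed.

Lemma measurable_vmap (m : nat) (i : 'I_(vdim m)) :
  measurable_fun setT (fun s : spd R m => vmap s 0 i).
Proof.
rewrite /vmap; case: (split_ordP i) => j ->.
  under eq_fun do rewrite row_mxEl mxE; exact: measurable_cholesky.
under eq_fun do rewrite row_mxEr mxE.
exact: (measurableT_comp (measurable_ln (R := R)) (measurable_cholesky _ _)).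
Qed.

End cholesky.

(** * Distances to a codebook *)

Section min_sqdist.
Context (R : realType) (d : nat).
Implicit Types z x a : 'rV[R]_d.

Lemma enorm_sqr x : enorm x ^+ 2 = \sum_(i < d) x 0 i ^+ 2.
Proof. by rewrite sqr_sqrtr// sumr_ge0// => i _; exact: sqr_ge0. Qed.

Lemma sqdistE x a : enorm (x - a) ^+ 2 = \sum_(i < d) (x 0 i - a 0 i) ^+ 2.
Proof. by rewrite enorm_sqr; apply: eq_bigr => i _; rewrite !mxE. Qed.

Lemma coord_le_enorm x (r : R) i :
  0 <= r -> enorm x ^+ 2 <= r -> `|x 0 i| <= Num.sqrt r.
Proof.
move=> r0 xr; rewrite -(sqrtr_sqr (x 0 i)) ler_wsqrtr//.
apply: le_trans xr; rewrite enorm_sqr (bigD1 i)//= lerDl sumr_ge0//.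
by move=> j _; exact: sqr_ge0.
Qed.

Let has_lbound_sqdist z (A : set 'rV[R]_d) :
  has_lbound [set enorm (z - a) ^+ 2 | a in A].
Proof. by exists 0 => _ [a _ <-]; exact: sqr_ge0. Qed.

Lemma min_sqdist_ge0 z (A : set 'rV[R]_d) : 0 <= min_sqdist z A.
Proof.
rewrite /min_sqdist; have [->|/set0P[a Aa]] := eqVneq A set0.
  by rewrite image_set0 inf0.
apply: lb_le_inf; first by exists (enorm (z - a) ^+ 2), a.
by move=> _ [b _ <-]; exact: sqr_ge0.
Qed.

Section codebook.
Context (k : nat).
Implicit Types c : 'I_k.+1 -> 'rV[R]_d.

Lemma min_sqdist_le z c j : min_sqdist z (range c) <= enorm (z - c j) ^+ 2.
Proof. by apply: ge_inf => //; exists (c j) => //; exists j. Qed.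

(** As a finite minimum, the distance is both attained and measurable in the observation. *)
Lemma min_sqdist_bigmin z c : min_sqdist z (range c) =
  \big[Num.min/enorm (z - c ord0) ^+ 2]_(j < k.+1) enorm (z - c j) ^+ 2.
Proof.
apply/eqP; rewrite eq_le; apply/andP; split.
  by apply/bigmin_geP; split => [|j _]; exact: min_sqdist_le.
apply: lb_le_inf; first by exists (enorm (z - c ord0) ^+ 2), (c ord0) => //; exists ord0.
by move=> _ [_ [j _ <-] <-]; exact: bigmin_le_cond.
Qed.

Lemma min_sqdist_attained z c :
  exists j, min_sqdist z (range c) = enorm (z - c j) ^+ 2.
Proof.
have [j _ jmin] := @Order.TotalTheory.arg_minP _ _ _ ord0 xpredT
  (fun j => enorm (z - c j) ^+ 2) isT.
exists j; apply/eqP; rewrite eq_le min_sqdist_le /=.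
rewrite min_sqdist_bigmin; apply/bigmin_geP; split => [|i _]; exact: jmin.
Qed.

Lemma le_min_sqdist z c c' :
  (forall j, exists i, enorm (z - c' i) ^+ 2 <= enorm (z - c j) ^+ 2) ->
  min_sqdist z (range c') <= min_sqdist z (range c).
Proof.
move=> cc'; have [j ->] := min_sqdist_attained z c.
by have [i] := cc' j; apply: le_trans; exact: min_sqdist_le.
Qed.

Lemma card_between_range c : card_between_1_and k.+1 (range c).
Proof.
split; first by exists (c ord0), ord0.
rewrite (_ : range c = (fun i => c (inord i)) @` `I_k.+1).
  exact: card_image_le.
apply/seteqP; split => [_ [j _ <-]|_ [i _ <-]]; last by exists (inord i).
by exists j; [exact: ltn_ord|rewrite inord_val].
Qed.

End codebook.

(** The codebook inverts an injection of [A] into [I_k]; indices outside its image repeat the point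
    [a], which is why [A] must be nonempty. *)
Lemma card_between_codebook (k : nat) (A : set 'rV[R]_d) :
  card_between_1_and k A -> exists c : 'I_k -> 'rV[R]_d, range c = A.
Proof.
move=> [[a Aa] /pcard_leP[f]].
pose c (j : 'I_k) := xget a [set b | A b /\ f b = j].
exists c; apply/seteqP; split => [_ [j _ <-]|b Ab].
  by rewrite /c; case: xgetP => [b _ []|].
have fb : (f b < k)%N by apply: (@funS _ _ _ _ f).
exists (Ordinal fb) => //; rewrite /c; case: xgetP => [b' _ [Ab' /= fb']|].
  by apply: (@inj _ _ _ f); rewrite ?inE.
by move=> /(_ b) /=; case.
Qed.

Section clip.
Context (rho : R).

Definition clip x : 'rV[R]_d :=
  \row_i Num.max (- rho) (Num.min rho (x 0 i)).

Lemma clip_bound x i : 0 <= rho -> `|clip x 0 i| <= rho.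
Proof.
move=> rho0; rewrite mxE ler_norml le_max lexx /= ge_max ge_min lexx andbT.
by rewrite (le_trans _ rho0)// oppr_le0.
Qed.

Let clip_coord t : 0 <= rho ->
  [\/ rho < t /\ Num.max (- rho) (Num.min rho t) = rho,
      t < - rho /\ Num.max (- rho) (Num.min rho t) = - rho |
      `|t| <= rho /\ Num.max (- rho) (Num.min rho t) = t].
Proof.
move=> rho0; rewrite ler_norml; have [t1|t1] := ltP rho t.
  by constructor 1; split=> //; apply/max_idPr; lra.
have [t2|t2] := ltP t (- rho).
  by constructor 2; split=> //; apply/max_idPl; lra.
by constructor 3.
Qed.

Lemma le_sqdist_clip z x : 0 <= rho -> (forall i, `|z 0 i| <= rho) ->
  enorm (z - clip x) ^+ 2 <= enorm (z - x) ^+ 2.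
Proof.
move=> rho0 zrho; rewrite !sqdistE; apply: ler_sum => i _; rewrite mxE.
have := zrho i; rewrite ler_norml => /andP[z1 z2].
by have [[? ->]|[? ->]|[? ->]] := clip_coord (x 0 i) rho0; nra.
Qed.

Lemma lt_sqdist_clip z x i : 0 <= rho -> (forall i, `|z 0 i| <= rho) ->
  rho < `|x 0 i| -> enorm (z - clip x) ^+ 2 < enorm (z - x) ^+ 2.
Proof.
move=> rho0 zrho xi; rewrite !sqdistE (bigD1 i)//= [ltRHS](bigD1 i)//=.
have term j : (z 0 j - clip x 0 j) ^+ 2 <= (z 0 j - x 0 j) ^+ 2.
  have := zrho j; rewrite ler_norml mxE => /andP[z1 z2].
  by have [[? ->]|[? ->]|[? ->]] := clip_coord (x 0 j) rho0; nra.
apply: ltr_leD; last by apply: ler_sum => j _; exact: term.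
have := zrho i; rewrite ler_norml mxE => /andP[z1 z2].
have [[? ->]|[? ->]|[+ _]] := clip_coord (x 0 i) rho0; [nra|nra|].
by rewrite leNgt xi.
Qed.

End clip.

(** Coordinatewise the squares differ by [(y - x) * (2 * p - x - y)], whose second factor is at most
    [4 * rho]. The increment is written [rho * e] for codebooks rescaled to the unit box; the
    resulting constant is also the bound of [min_sqdist_bound], so one [K] serves both purposes. *)
Lemma lip_min_sqdist (k : nat) (rho e : R) z (c c' : 'I_k.+1 -> 'rV[R]_d) :
  0 <= rho -> (forall i, `|z 0 i| <= rho) ->
  (forall j i, `|c j 0 i| <= rho) -> (forall j i, `|c' j 0 i| <= rho) ->
  (forall j i, `|c j 0 i - c' j 0 i| <= rho * e) ->
  `|min_sqdist z (range c) - min_sqdist z (range c')| <=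
    4 * d%:R * rho ^+ 2 * e.
Proof.
move=> rho0 zrho crho c'rho cc'.
wlog suff : c c' crho c'rho cc' / min_sqdist z (range c) <=
    min_sqdist z (range c') + 4 * d%:R * rho ^+ 2 * e.
  move=> h; rewrite ler_norml; apply/andP; split; last first.
    by rewrite lerBlDl; exact: h.
  rewrite lerBrDr addrC lerBlDr; apply: h => // j i.
  by rewrite distrC.
have [j ->] := min_sqdist_attained z c'.
apply: le_trans (min_sqdist_le z c j) _; rewrite !sqdistE.
rewrite (_ : 4 * d%:R * rho ^+ 2 * e = \sum_(i < d) 4 * rho ^+ 2 * e); last first.
  by rewrite sumr_const card_ord -mulr_natr; ring.
rewrite -big_split/=; apply: ler_sum => i _.
rewrite -lerBlDl; set p := z 0 i; set x := c j 0 i; set y := c' j 0 i.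
have -> : (p - x) ^+ 2 - (p - y) ^+ 2 = (y - x) * (2 * p - x - y) by ring.
apply: le_trans (ler_norm _) _; rewrite normrM.
apply: (@le_trans _ _ (rho * e * (4 * rho))); last first.
  by rewrite le_eqVlt; apply/orP; left; apply/eqP; ring.
apply: ler_pM => //; first by rewrite distrC; exact: cc'.
have := zrho i; have := crho j i; have := c'rho j i.
rewrite -/p -/x -/y !ler_norml => /andP[? ?] /andP[? ?] /andP[? ?].
by apply/andP; split; lra.
Qed.

Lemma min_sqdist_bound (k : nat) (rho : R) z (c : 'I_k.+1 -> 'rV[R]_d) :
  0 <= rho -> (forall i, `|z 0 i| <= rho) -> (forall j i, `|c j 0 i| <= rho) ->
  min_sqdist z (range c) <= 4 * d%:R * rho ^+ 2.
Proof.
move=> rho0 zrho crho; apply: le_trans (min_sqdist_le z c ord0) _.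
rewrite sqdistE (_ : 4 * d%:R * rho ^+ 2 = \sum_(i < d) 4 * rho ^+ 2); last first.
  by rewrite sumr_const card_ord -mulr_natr; ring.
apply: ler_sum => i _; have := zrho i; have := crho ord0 i.
by rewrite !ler_norml => /andP[? ?] /andP[? ?]; nra.
Qed.

End min_sqdist.

Section nonmeasurable.
Import HBNNSimple.

(* A nonnegative function need not be measurable here: its integral is the
   supremum of the integrals of the simple functions below it. *)
Lemma ge0_ae_le_integral_nonmeasurable d (T : measurableType d) (R : realType)
    (P : {measure set T -> \bar R}) (f g : T -> \bar R) :
  (forall w, 0 <= f w)%E -> (forall w, 0 <= g w)%E ->
  {ae P, forall w, (f w <= g w)%E} -> (\int[P]_w f w <= \int[P]_w g w)%E.
Proof.
move=> f0 g0 [N [mN N0 fgN]]; rewrite !ge0_integralTE//.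
apply: ge_ereal_sup => _ [h /= hf <-].
have mNC : measurable (~` N) by exact: measurableC.
(* Setting [h] to 0 on the null set [N] puts it below [g] everywhere and keeps its integral. *)
pose h' := proj_nnsfun h mNC.
apply: le_ereal_sup_tmp; exists (sintegral P h').
  exists h' => // w; suff: ((h w * \1_(~` N) w)%:E <= g w)%E by [].
  rewrite indicE.
  have [wN|/negPn] := boolP (w \in ~` N); rewrite ?mulr0 ?mulr1//.
  apply: le_trans (hf w) _; apply: contrapT => fg.
  by move: wN; rewrite inE; apply; exact: fgN.
rewrite -!integralT_nnsfun le_eqVlt; apply/orP; left; apply/eqP.
apply: ge0_ae_eq_integral => //.
- by apply/measurable_EFinP.
- by apply/measurable_EFinP.
- by move=> w _; rewrite lee_fin.
- by move=> w _; rewrite lee_fin.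
exists N; split => // w /= hw; apply: contrapT => wN; apply: hw => _.
by rewrite mindicE mem_set// mulr1.
Qed.

End nonmeasurable.

(** * Empirical k-means *)

Section kmeans.
Context (R : realType) (m k : nat) (r : R).
Hypothesis r0 : 0 < r.
Implicit Types c : 'I_k.+1 -> 'rV[R]_(vdim m).

Let rho := Num.sqrt r.
Let rho0 : 0 <= rho. Proof. exact: sqrtr_ge0. Qed.
Let rhogt0 : 0 < rho. Proof. by rewrite sqrtr_gt0. Qed.
Let rho2 : rho ^+ 2 = r. Proof. by rewrite sqr_sqrtr// ltW. Qed.

Definition vball : set (spd R m) := [set s | enorm (vmap s) ^+ 2 <= r].

Lemma vball_coord s i : vball s -> `|vmap s 0 i| <= rho.
Proof. by move=> sr; apply: coord_le_enorm; [exact: ltW|]. Qed.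

Lemma measurable_vball : measurable vball.
Proof.
rewrite (_ : vball = setT `&`
    (fun s => \sum_i vmap s 0 i ^+ 2) @^-1` `]-oo, r]%classic); last first.
  by rewrite setTI; apply/seteqP; split => s; rewrite /vball/= enorm_sqr in_itv.
have mf : measurable_fun setT (fun s : spd R m => \sum_i vmap s 0 i ^+ 2).
  by apply: measurable_sum => i; apply: measurable_funX; exact: measurable_vmap.
exact: mf.
Qed.

Lemma measurable_min_sqdist (c : 'I_k.+1 -> 'rV[R]_(vdim m)) :
  measurable_fun setT (fun s => min_sqdist (vmap s) (range c)).
Proof.
have msq j : measurable_fun setT (fun s : spd R m => enorm (vmap s - c j) ^+ 2).
  under eq_fun do rewrite sqdistE.
  apply: measurable_sum => i; apply: measurable_funX.
  by apply: measurable_funB => //; exact: measurable_vmap.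
under eq_fun do rewrite min_sqdist_bigmin.
elim: (index_enum _) => [|j l IH].
  by under eq_fun do rewrite big_nil; exact: msq.
under eq_fun do rewrite big_cons.
exact: measurable_minr.
Qed.

(* Rescaled so that the codebooks in the cube are parametrised by in_box. *)
Let codebook (x : 'I_k.+1 * 'I_(vdim m) -> R) (j : 'I_k.+1) :
  'rV[R]_(vdim m) := \row_i (rho * x (j, i)).

Let uncodebook (c : 'I_k.+1 -> 'rV[R]_(vdim m)) (p : 'I_k.+1 * 'I_(vdim m)) :=
  c p.1 0 p.2 / rho.

Let codebookK c : codebook (uncodebook c) = c.
Proof.
apply/funext => j; apply/rowP => i; rewrite mxE /uncodebook/=.
by rewrite mulrC divfK// gt_eqF.
Qed.

Let uncodebook_in_box (c : 'I_k.+1 -> 'rV[R]_(vdim m)) :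
  (forall j i, `|c j 0 i| <= rho) ->
  in_box (uncodebook c).
Proof.
move=> crho [j i]; rewrite /uncodebook/=; have := crho j i.
rewrite ler_norml => /andP[c1 c2].
by rewrite ler_pdivlMr// ler_pdivrMr// mulN1r mul1r c1 c2.
Qed.

Let codebook_bound x : in_box x -> forall j i, `|codebook x j 0 i| <= rho.
Proof.
move=> xb j i; rewrite mxE normrM (ger0_norm rho0) ler_piMr//.
by rewrite ler_norml xb.
Qed.

(** Truncation to the support makes the boundedness and Lipschitz estimates hold at every point, as
    the chaining bounds require, without changing integrals against [PS]. *)
Definition trunc_risk (c : 'I_k.+1 -> 'rV[R]_(vdim m)) (s : spd R m) : R :=
  \1_vball s * min_sqdist (vmap s) (range c).

Lemma trunc_riskE c s : vball s ->
  trunc_risk c s = min_sqdist (vmap s) (range c).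
Proof. by move=> sr; rewrite /trunc_risk indicE mem_set// mul1r. Qed.

Lemma trunc_risk_out c s : ~ vball s -> trunc_risk c s = 0.
Proof. by move=> sr; rewrite /trunc_risk indicE memNset// mul0r. Qed.

Lemma trunc_risk_ge0 c s : 0 <= trunc_risk c s.
Proof. by rewrite mulr_ge0// min_sqdist_ge0. Qed.

Lemma measurable_trunc_risk c : measurable_fun setT (trunc_risk c).
Proof.
apply: measurable_funM; last exact: measurable_min_sqdist.
by apply: measurable_indic; exact: measurable_vball.
Qed.

Let K : R := 4 * (vdim m)%:R * r.

Let F (x : 'I_k.+1 * 'I_(vdim m) -> R) := trunc_risk (codebook x).

Let K0 : 0 <= K.
Proof. by rewrite /K !mulr_ge0// ltW. Qed.

Let mF x : measurable_fun setT (F x).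
Proof. exact: measurable_trunc_risk. Qed.

Let F_bound x s : in_box x -> `|F x s| <= K.
Proof.
move=> xb; rewrite ger0_norm ?trunc_risk_ge0//.
have [sr|sr] := pselect (vball s); last by rewrite /F trunc_risk_out.
rewrite /F trunc_riskE// /K -rho2; apply: min_sqdist_bound => //.
- by move=> i; exact: vball_coord.
- exact: codebook_bound.
Qed.

Let F_lip (x x' : 'I_k.+1 * 'I_(vdim m) -> R) (e : R) s : in_box x -> in_box x' ->
  (forall i, `|x i - x' i| <= e) -> `|F x s - F x' s| <= K * e.
Proof.
move=> xb x'b xx'.
have [sr|sr] := pselect (vball s); last first.
  rewrite /F !trunc_risk_out// subrr normr0.
  (* The claim needs [0 <= e], which any coordinate of the parameter provides; if there is none, [K]
     is 0. *)
  have [v0|v0] := posnP (vdim m); first by rewrite /K v0 mulr0 !mul0r.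
  by rewrite mulr_ge0//; exact: le_trans (xx' (ord0, Ordinal v0)).
rewrite /F !trunc_riskE// /K -rho2; apply: lip_min_sqdist => //.
- by move=> i; exact: vball_coord.
- exact: codebook_bound.
- exact: codebook_bound.
move=> j i; rewrite !mxE -mulrBr normrM (ger0_norm rho0).
by rewrite ler_wpM2l.
Qed.

Section risk.
Context (PS : probability (spd R m) R).
Hypothesis PSball : PS vball = 1%E.

Lemma negligible_vballC : PS (~` vball) = 0%E.
Proof. by rewrite probability_setC ?PSball ?subee//; exact: measurable_vball. Qed.

Lemma Qrisk_trunc (c : 'I_k.+1 -> 'rV[R]_(vdim m)) :
  Qrisk (range c) PS = (\int[PS]_s (trunc_risk c s)%:E)%E.
Proof.
rewrite /Qrisk unlock; apply: ge0_ae_eq_integral => //.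
- by apply/measurable_EFinP; exact: measurable_min_sqdist.
- by apply/measurable_EFinP; exact: measurable_trunc_risk.
- by move=> s _; rewrite lee_fin min_sqdist_ge0.
- by move=> s _; rewrite lee_fin trunc_risk_ge0.
exists (~` vball); split.
- by apply: measurableC; exact: measurable_vball.
- exact: negligible_vballC.
by move=> s /= h sr; apply: h => _; rewrite trunc_riskE.
Qed.

Lemma le_Qrisk (c c' : 'I_k.+1 -> 'rV[R]_(vdim m)) :
  (forall s, vball s -> min_sqdist (vmap s) (range c) <=
                        min_sqdist (vmap s) (range c')) ->
  (Qrisk (range c) PS <= Qrisk (range c') PS)%E.
Proof.
move=> cc'; rewrite !Qrisk_trunc; apply: ge0_le_integral => //.
- by move=> s _; rewrite lee_fin trunc_risk_ge0.
- by apply/measurable_EFinP; exact: measurable_trunc_risk.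
- by apply/measurable_EFinP; exact: measurable_trunc_risk.
move=> s _; rewrite lee_fin; have [sr|sr] := pselect (vball s).
  by rewrite !trunc_riskE// cc'.
by rewrite !trunc_risk_out.
Qed.

Lemma Qrisk_fin (c : 'I_k.+1 -> 'rV[R]_(vdim m)) : (forall j i, `|c j 0 i| <= rho) ->
  Qrisk (range c) PS = (\int[PS]_s trunc_risk c s)%:E.
Proof.
move=> crho; rewrite Qrisk_trunc /Rintegral fineK//.
apply: integrable_fin_num => //; rewrite -(codebookK c).
apply: (bounded_integrable PS (mF (uncodebook c)) (b := K)) => s.
by apply: F_bound; exact: uncodebook_in_box.
Qed.

Lemma opt_risk_ge0 : (0 <= opt_risk k.+1 PS)%E.
Proof.
apply: le_ereal_inf_tmp => _ [A _ <-]; rewrite /Qrisk unlock.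
by apply: integral_ge0 => s _; rewrite lee_fin min_sqdist_ge0.
Qed.

Lemma opt_risk_le c : (opt_risk k.+1 PS <= Qrisk (range c) PS)%E.
Proof.
by apply: ereal_inf_lbound; exists (range c) => //; exact: card_between_range.
Qed.

Lemma opt_risk_fin : opt_risk k.+1 PS \is a fin_num.
Proof.
rewrite ge0_fin_numE ?opt_risk_ge0//; apply: le_lt_trans (opt_risk_le (fun=> 0)) _.
by rewrite Qrisk_fin ?ltry// => j i; rewrite mxE normr0.
Qed.

(** * Comparison on one fixed sample *)

Section sample.
Context d (Omega : measurableType d) (P : probability Omega R)
  (S : nat -> {RV P >-> spd R m}).
Context (n : nat) (w : Omega) (M : R) (X : 'I_k.+1 -> 'rV[R]_(vdim m)).
Hypothesis n0 : (0 < n)%N.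
Hypothesis sample_ball : forall i, vball (S i w).
Hypothesis X_min : is_minimiser (sample S n w) X.
Hypothesis dev_le : forall x, in_box x -> `|deviation S PS (F x) n w| <= M.

Let kmeans_objE c : kmeans_obj (sample S n w) c =
  n%:R^-1 * \sum_(i < n) min_sqdist (vmap (S i w)) (range c).
Proof.
by congr (_ * _); apply: eq_bigr => i _; rewrite tnth_mktuple.
Qed.

Let Qrisk_dev (c : 'I_k.+1 -> 'rV[R]_(vdim m)) : (forall j i, `|c j 0 i| <= rho) ->
  `|\int[PS]_s trunc_risk c s - kmeans_obj (sample S n w) c| <= M.
Proof.
move=> crho; have := dev_le (uncodebook_in_box crho).
rewrite /deviation /F codebookK kmeans_objE.
by under eq_bigr do rewrite trunc_riskE//.
Qed.

(* If some sample point had its nearest centre outside the cube, clipping the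
   centres would strictly decrease the objective. *)
Lemma minimiser_nearest_in_box i j : (i < n)%N ->
  min_sqdist (vmap (S i w)) (range X) = enorm (vmap (S i w) - X j) ^+ 2 ->
  forall l, `|X j 0 l| <= rho.
Proof.
move=> ni ij l; rewrite leNgt; apply/negP => Xl.
pose Y j := clip rho (X j).
have zrho a := fun b => vball_coord b (sample_ball a).
have YX a : min_sqdist (vmap (S a w)) (range Y) <=
    min_sqdist (vmap (S a w)) (range X).
  by apply: le_min_sqdist => b; exists b; exact: le_sqdist_clip.
have := X_min Y; rewrite !kmeans_objE ler_pM2l ?invr_gt0 ?ltr0n//.
apply/negP; rewrite -ltNge (bigD1 (Ordinal ni))//= [ltRHS](bigD1 (Ordinal ni))//=.
apply: ltr_leD; last by apply: ler_sum => a _; exact: YX.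
rewrite ij; apply: le_lt_trans (min_sqdist_le _ Y j) _.
exact: lt_sqdist_clip Xl.
Qed.

(** Centres outside the cube serve no sample point, so they can be moved onto [X j0], the centre
    nearest to the first observation. Since no new centre appears, the risk of [X] is at most that
    of [X']. *)
Lemma minimiser_in_box : exists X' : 'I_k.+1 -> 'rV[R]_(vdim m),
  [/\ forall j i, `|X' j 0 i| <= rho, range X' `<=` range X &
      kmeans_obj (sample S n w) X' = kmeans_obj (sample S n w) X].
Proof.
have [j0 hj0] := min_sqdist_attained (vmap (S 0%N w)) X.
have Xj0 := minimiser_nearest_in_box n0 hj0.
pose X' j := if [forall i, `|X j 0 i| <= rho] then X j else X j0.
exists X'; split.
- by move=> j i; rewrite /X'; case: ifPn => [/forallP//|_].
- by move=> _ [j _ <-]; rewrite /X'; case: ifPn => _; [exists j|exists j0].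
rewrite !kmeans_objE; congr (_ * _); apply: eq_bigr => i _.
apply/eqP; rewrite eq_le; apply/andP; split.
  have [j hj] := min_sqdist_attained (vmap (S i w)) X.
  have Xj := minimiser_nearest_in_box (ltn_ord i) hj.
  rewrite hj; apply: le_trans (min_sqdist_le _ X' j) _.
  by rewrite /X' (introT forallP Xj).
apply: le_min_sqdist => j; rewrite /X'.
by case: ifPn => _; [exists j|exists j0].
Qed.

(** For a competitor [Y] with clipped version [Y'], the chain is [Q(X) <= Q(X') <= D(X') + M = D(X)
    + M <= D(Y') + M <= Q(Y') + 2 * M <= Q(Y) + 2 * M], where [Q] is the risk and [D] the objective;
    then comes the infimum over [Y]. *)
Lemma Qrisk_minimiser_le : (Qrisk (range X) PS <= opt_risk k.+1 PS + (2 * M)%:E)%E.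
Proof.
have [X' [X'rho X'X objX']] := minimiser_in_box.
rewrite -leeBlDr//; apply: le_ereal_inf_tmp => _ [_ /card_between_codebook[Y <-] <-].
pose Y' j := clip rho (Y j).
have Y'rho j i : `|Y' j 0 i| <= rho by exact: clip_bound.
have Y'Y : (Qrisk (range Y') PS <= Qrisk (range Y) PS)%E.
  apply: le_Qrisk => s sr; apply: le_min_sqdist => j; exists j.
  by apply: le_sqdist_clip => // i; exact: vball_coord.
have XX' : (Qrisk (range X) PS <= Qrisk (range X') PS)%E.
  apply: le_Qrisk => s sr; apply: le_min_sqdist => j.
  by have [i _ <-] := X'X (X' j) (ex_intro2 _ _ j I erefl); exists i.
rewrite leeBlDr//; apply: le_trans XX' _.
apply: (@le_trans _ _ (Qrisk (range Y') PS + (2 * M)%:E)%E); last by rewrite leeD2r.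
rewrite !Qrisk_fin// -EFinD lee_fin.
have := Qrisk_dev X'rho; have := Qrisk_dev Y'rho; have := X_min Y'.
by rewrite objX' !ler_norml => h /andP[h1 h2] /andP[h3 h4]; lra.
Qed.

Lemma opt_risk_le_minimiser :
  (opt_risk k.+1 PS <= (kmeans_obj (sample S n w) X + M)%:E)%E.
Proof.
have [X' [X'rho X'X objX']] := minimiser_in_box.
apply: le_trans (opt_risk_le X') _; rewrite Qrisk_fin// lee_fin -objX'.
by have := Qrisk_dev X'rho; rewrite ler_norml => /andP[_]; lra.
Qed.

End sample.

(** * Integration over the sample *)

Section sampling.
Context d (Omega : measurableType d) (P : probability Omega R)
  (S : nat -> {RV P >-> spd R m}).
Hypothesis iidS : iid_with_law S PS.

Lemma ae_sample_ball : {ae P, forall w, forall i, vball (S i w)}.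
Proof.
have mi i : measurable (S i @^-1` (~` vball)).
  rewrite -[X in measurable X]setTI; apply: measurable_funP => //.
  by apply: measurableC; exact: measurable_vball.
exists (\bigcup_i (S i @^-1` (~` vball))); split.
- exact: bigcup_measurable.
- apply/negligibleP; first exact: bigcup_measurable.
  apply: negligible_bigcup => i; apply/negligibleP => //.
  have mC : measurable (~` vball) by apply: measurableC; exact: measurable_vball.
  exact: eq_trans (iid_law iidS i mC) negligible_vballC.
- by move=> w /= /existsNP[i Si]; exists i.
Qed.

Definition risk_const : R := chaining_const ('I_k.+1 * 'I_(vdim m))%type K.

Lemma expected_Qrisk_minimiser n
    (X : n.-tuple (spd R m) -> 'I_k.+1 -> 'rV[R]_(vdim m)) :
  (0 < n)%N -> (forall s, is_minimiser s (X s)) ->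
  (\int[P]_w Qrisk (range (X (sample S n w))) PS - opt_risk k.+1 PS <=
   (2 * risk_const / Num.sqrt n%:R)%:E)%E.
Proof.
move=> n0 Xmin.
have [M [mM M0 devM IM]] := uniform_deviation_expectation iidS K0 mF F_bound F_lip n0.
have o0 := opt_risk_ge0; have ofin := opt_risk_fin.
have mM2 : measurable_fun setT (fun w => (2 * M w)%:E).
  by apply/measurable_EFinP; exact: measurable_funM.
have M20 w : (0 <= (2 * M w)%:E)%E by rewrite lee_fin mulr_ge0.
have h : (\int[P]_w Qrisk (range (X (sample S n w))) PS <=
    \int[P]_w (opt_risk k.+1 PS + (2 * M w)%:E))%E.
  apply: ge0_ae_le_integral_nonmeasurable => [w|w|].
  - by rewrite Qrisk_trunc integral_ge0// => s _; rewrite lee_fin trunc_risk_ge0.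
  - by rewrite adde_ge0.
  - apply: filterS ae_sample_ball => w wball.
    by apply: (Qrisk_minimiser_le n0 wball (Xmin _)) => x xb; exact: devM.
rewrite leeBlDr//; apply: le_trans h _.
rewrite ge0_integralD// integral_cst// [X in (_ * X + _)%E](_ : _ = 1%E);
  last exact: probability_setT.
rewrite mule1 addeC leeD2r//; under eq_integral do rewrite EFinM.
rewrite ge0_integralZl_EFin//; last 2 first.
- by move=> w _; rewrite lee_fin.
- exact/measurable_EFinP.
by rewrite -mulrA EFinM lee_wpmul2l.
Qed.

Lemma expected_kmeans_obj_minimiser n
    (X : n.-tuple (spd R m) -> 'I_k.+1 -> 'rV[R]_(vdim m)) :
  (0 < n)%N -> (forall s, is_minimiser s (X s)) ->
  (opt_risk k.+1 PS -
     'E_P[fun w => kmeans_obj (sample S n w) (X (sample S n w))] <=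
   (risk_const / Num.sqrt n%:R)%:E)%E.
Proof.
move=> n0 Xmin.
have [M [mM M0 devM IM]] := uniform_deviation_expectation iidS K0 mF F_bound F_lip n0.
have o0 := opt_risk_ge0; have ofin := opt_risk_fin.
have obj0 w : (0 <= (kmeans_obj (sample S n w) (X (sample S n w)))%:E)%E.
  rewrite lee_fin mulr_ge0// sumr_ge0// => i _; exact: min_sqdist_ge0.
have M0' w : (0 <= (M w)%:E)%E by rewrite lee_fin.
(* The positive part keeps both sides nonnegative, as the comparison of integrals requires, while
   [g + M] still dominates the optimal risk. *)
pose g w := Num.max 0 (fine (opt_risk k.+1 PS) - M w).
have g0 w : (0 <= (g w)%:E)%E by rewrite lee_fin le_max lexx.
have mg : measurable_fun setT g.
  by apply: measurable_maxr => //; exact: measurable_funB.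
have h : (\int[P]_w (g w)%:E <=
    \int[P]_w (kmeans_obj (sample S n w) (X (sample S n w)))%:E)%E.
  apply: ge0_ae_le_integral_nonmeasurable => //.
  apply: filterS ae_sample_ball => w wball.
  rewrite lee_fin ge_max -lee_fin obj0/= lerBlDr -lee_fin fineK//.
  by apply: (opt_risk_le_minimiser n0 wball (Xmin _)) => x xb; exact: devM.
have gM : (opt_risk k.+1 PS <= \int[P]_w (g w)%:E + \int[P]_w (M w)%:E)%E.
  rewrite -ge0_integralD//; last 2 first.
  - exact/measurable_EFinP.
  - exact/measurable_EFinP.
  have -> : opt_risk k.+1 PS = (\int[P]_w opt_risk k.+1 PS)%E.
    rewrite integral_cst// [X in (_ * X)%E](_ : _ = 1%E) ?mule1//.
    exact: probability_setT.
  apply: ge0_le_integral => //.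
    by apply: emeasurable_funD; exact/measurable_EFinP.
  move=> w _; rewrite -(fineK ofin) -EFinD lee_fin -lerBlDr.
  by rewrite le_max lexx orbT.
rewrite unlock; apply: (@le_trans _ _ (\int[P]_w (M w)%:E)%E) => //.
(* If the expected objective is infinite, the left-hand side is [-oo]. *)
set e := (X in (_ - X <= _)%E); have [efin|] := boolP (e \is a fin_num).
  by rewrite leeBlDr// addeC (le_trans gM)// leeD2r.
rewrite ge0_fin_numE ?integral_ge0// -leNgt leye_eq => /eqP ->.
by rewrite -(fineK ofin) /= leNye.
Qed.

Lemma ae_Qrisk_minimiser
    (X : forall n : nat, n.-tuple (spd R m) -> 'I_k.+1 -> 'rV[R]_(vdim m)) :
  (forall n, (0 < n)%N -> forall s, is_minimiser s (X n s)) ->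
  {ae P, forall w,
    (fun n : nat =>
       fine (Qrisk (range (X n (sample S n w))) PS - opt_risk k.+1 PS)) =O_\oo
    (fun n : nat => Num.sqrt (ln n%:R) / Num.sqrt n%:R)}.
Proof.
move=> Xmin; have ofin := opt_risk_fin.
have [c hc] := uniform_deviation_ae iidS K0 mF F_bound F_lip.
apply: filterS2 ae_sample_ball hc => w wball wdev.
apply/eqOP; near=> C; near=> n.
have n0 : (0 < n)%N by near: n; exists 1%N.
have dev x : in_box x -> `|deviation S PS (F x) n w| <=
    c * (Num.sqrt (ln n%:R) / Num.sqrt n%:R).
  by move: x; near: n; exact: wdev.
set t := Num.sqrt (ln n%:R) / Num.sqrt n%:R in dev *.
have t0 : 0 <= t by rewrite divr_ge0.
have up := Qrisk_minimiser_le n0 wball (Xmin n n0 _) dev.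
have lo := opt_risk_le (X n (sample S n w)).
have qfin : Qrisk (range (X n (sample S n w))) PS \is a fin_num.
  rewrite ge0_fin_numE ?(le_trans opt_risk_ge0)//.
  apply: le_lt_trans up _; rewrite -(fineK ofin) -EFinD ltry//.
rewrite fineB// ger0_norm; last by rewrite subr_ge0 fine_le.
rewrite (ger0_norm t0).
(* Any [C >= 2 * c] serves as the implied constant, which may depend on [w]. *)
apply: (@le_trans _ _ (2 * (c * t))).
  by rewrite lerBlDl -lee_fin EFinD !fineK.
by rewrite mulrA ler_wpM2r//; near: C; exact: nbhs_pinfty_ge.
Unshelve. all: by end_near. Qed.

End sampling.
End risk.
End kmeans.

Theorem proposition3 (R : realType) (m k : nat) (r : R) :
  (1 <= m)%N -> (1 <= k)%N -> 0 < r ->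
  exists C1 C2 : R,
  forall (d : measure_display) (Omega : measurableType d)
    (P : probability Omega R) (S : nat -> {RV P >-> spd R m})
    (PS : probability (spd R m) R)
    (X : forall n : nat, n.-tuple (spd R m) -> 'I_k -> 'rV[R]_(vdim m)),
  iid_with_law S PS ->
  ('E_PS[fun s => (enorm (vmap s) ^+ 2)%R] < +oo)%E ->
  (forall j : nat, (1 <= j <= k)%N ->
     exists! A : set 'rV[R]_(vdim m),
       card_between_1_and j A /\ Qrisk A PS = opt_risk j PS) ->
  PS [set s | enorm (vmap s) ^+ 2 <= r] = 1%E ->
  (forall n : nat, (1 <= n)%N ->
     (forall (j : 'I_k) (i : 'I_(vdim m)),
        measurable_fun setT (fun s : n.-tuple (spd R m) => X n s j 0 i)) /\
     (forall s : n.-tuple (spd R m), is_minimiser s (X n s))) ->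
  [/\ forall n : nat, (1 <= n)%N ->
        (\int[P]_w Qrisk (range (X n (sample S n w))) PS - opt_risk k PS
           <= (C1 / Num.sqrt n%:R)%:E)%E,
      forall n : nat, (1 <= n)%N ->
        (opt_risk k PS
           - 'E_P[fun w => kmeans_obj (sample S n w) (X n (sample S n w))]
           <= (C2 / Num.sqrt n%:R)%:E)%E
    & {ae P, forall w,
        (fun n : nat =>
           fine (Qrisk (range (X n (sample S n w))) PS - opt_risk k PS)) =O_\oo
        (fun n : nat => Num.sqrt (ln n%:R) / Num.sqrt n%:R)}].
Proof.
case: k => [//|k] _ _ r0.
(* The risk bound pays for the deviation twice, at the minimiser and at the competitor; the
   objective bound pays once. *)
exists (2 * risk_const m k r), (risk_const m k r).
move=> d Omega P S PS X iidS _ _ PSball hX; split.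
- by move=> n n0; apply: (expected_Qrisk_minimiser r0 PSball iidS n0 (hX n n0).2).
- by move=> n n0; apply: (expected_kmeans_obj_minimiser r0 PSball iidS n0 (hX n n0).2).
- by apply: (ae_Qrisk_minimiser r0 PSball iidS) => n n0; exact: (hX n n0).2.
Qed.
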